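(* For every partition $\boldsymbol\lambda$, $$f^{\boldsymbol\lambda}=|\boldsymbol\lambda|!\cdot\Delta_{\boldsymbol\lambda}(\exp(t)).$$
   Context: A partition is a non-increasing sequence $\boldsymbol\lambda=(\lambda_1\ge\lambda_2\ge\cdots)$ of non-negative integers with finitely many nonzero terms; $|\boldsymbol\lambda|=\sum_i\lambda_i$. Schur determinant: for a formal power series $f(t)=\sum_{n\ge0}f_nt^n$ over a commutative $\mathbb Q$-algebra (with $f_n=0$ for $n<0$) and a partition $\boldsymbol\lambda$ with at most $r$ parts, $\Delta_{\boldsymbol\lambda}(f(t))=\det(f_{\lambda_j-j+i})_{1\le i,j\le r}$ (independent of the choice of such $r$). Here it is applied to $\exp(t)=\sum_{n\ge0}t^n/n!$. $f^{\boldsymbol\lambda}$ is the Plücker degree of the Schubert variety of dimension $|\boldsymbol\lambda|$ associated to $\boldsymbol\lambda$: if $\boldsymbol\lambda$ has at most $r$ parts and $\lambda_1\le n-r$, and $F_1\subsetneq\cdots\subsetneq F_r\subseteq\mathbb C^n$ is a flag of subspaces with $\dim F_i=i+\lambda_{r+1-i}$, then $f^{\boldsymbol\lambda}$ is the degree, in the Plücker embedding of the Grassmannian $G(r,n)$ of $r$-dimensional subspaces of $\mathbb C^n$, of $\{\Lambda\in G(r,n)\mid\dim(\Lambda\cap F_i)\ge i,\ 1\le i\le r\}$. Equivalently, $f^{\boldsymbol\lambda}=\int_{G(r,n)}c_1(\mathcal Q_r)^{|\boldsymbol\lambda|}\cap\Omega^{\boldsymbol\lambda}$, with $\mathcal Q_r$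 the universal quotient bundle and $\Omega^{\boldsymbol\lambda}$ the class of this Schubert variety. It does not depend on the choice of $r,n$, and it equals the number of standard Young tableaux of shape $\boldsymbol\lambda$. *)

(* Defs.v *)
From HB Require Import structures.
From mathcomp Require Import all_boot all_order all_algebra.
From mathcomp Require Import boolp classical_sets reals complex.
From mathcomp Require Import mpoly.

Set Implicit Arguments.
Unset Strict Implicit.
Unset Printing Implicit Defensive.

Import Order.TTheory GRing.Theory Num.Theory.

Local Open Scope ring_scope.

(* A partition is the list of its nonzero parts: lambda_(i+1) is
   [nth 0%N la i], the number of parts is [size la], and |lambda| is
   [sumn la]. *)
Definition is_partition (la : seq nat) : bool :=
  sorted geq la && (0%N \notin la).

(* The power series sum_n f n * t^n is given by its coefficients; [f k - j]
   with k < j is a coefficient of negative index, hence 0. *)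
Definition schur_det (A : comNzRingType) (r : nat) (la : seq nat)
    (f : nat -> A) : A :=
  \det (\matrix_(i < r, j < r)
    let k := (nth 0 la j + i)%N in if (j <= k)%N then f (k - j)%N else 0).

Definition exp_series (n : nat) : rat := (n`!)%:R^-1.

(* Points of the projective space P^(N-1) over K are the lines of K^N, that is
   the 1-dimensional L : {vspace 'rV[K]_N}. *)
Section ProjectiveDegree.

Variables (K : fieldType) (N : nat).
Implicit Types (X : set {vspace 'rV[K]_N}) (p : {mpoly K[N]}).

(* For p homogeneous, [vanishes_on X p] says that p lies in the homogeneous
   ideal I(X). *)
Definition vanishes_on X p : Prop :=
  forall L, X L -> forall v : 'rV[K]_N, v \in L -> p.@[fun i => v 0 i] = 0.

(* The degree-m component of the homogeneous coordinate ring K[x] / I(X) has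
   dimension h over K: the classes of some forms e_0, ..., e_(h-1) of degree m
   are a basis of it. *)
Definition coord_ring_dim X (m h : nat) : Prop :=
  exists e : 'I_h -> {mpoly K[N]},
    [/\ forall i, e i \is m.-homog,
        forall c : 'I_h -> K,
          vanishes_on X (\sum_i c i *: e i) -> forall i, c i = 0
      & forall p, p \is m.-homog ->
          exists c : 'I_h -> K, vanishes_on X (p - \sum_i c i *: e i)].

Definition is_hilbert_poly X (P : {poly rat}) : Prop :=
  exists m0 : nat, forall m : nat, (m0 <= m)%N ->
    exists2 h : nat, coord_ring_dim X m h & P.[m%:R] = h%:R.

Definition hilbert_poly X : {poly rat} := xget 0 [set P | is_hilbert_poly X P].

(* (dim X)! times the leading coefficient of the Hilbert polynomial of X, the
   degree of that polynomial being dim X. *)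
Definition degree X : rat :=
  ((size (hilbert_poly X)).-1)`!%:R * lead_coef (hilbert_poly X).

Lemma vanishes_onD X p q :
  vanishes_on X p -> vanishes_on X q -> vanishes_on X (p + q).
Proof.
by move=> hp hq L XL v vL; rewrite mevalD (hp L) // (hq L) // addr0.
Qed.

Lemma vanishes_onZ X a p : vanishes_on X p -> vanishes_on X (a *: p).
Proof. by move=> hp L XL v vL; rewrite mevalZ (hp L) // mulr0. Qed.

Lemma vanishes_on_sum X (I : finType) (F : I -> {mpoly K[N]}) :
  (forall i, vanishes_on X (F i)) -> vanishes_on X (\sum_i F i).
Proof.
move=> hF; apply: big_ind => //; last by move=> p q; exact: vanishes_onD.
by move=> L XL v vL; rewrite meval0.
Qed.

Lemma coord_ring_dim_leq X m h h' :
  coord_ring_dim X m h -> coord_ring_dim X m h' -> (h' <= h)%N.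
Proof.
move=> [e [_ _ espan]] [e' [e'hom e'free _]].
have /choice[A hA] : forall j : 'I_h', exists c : 'I_h -> K,
    vanishes_on X (e' j - \sum_i c i *: e i) by move=> j; exact: espan.
pose M := \matrix_(j < h', i < h) A j i.
suff /eqP <- : row_free M by exact: rank_leq_col.
apply/row_freeP; apply/row_freeP/inj_row_free => v vM0.
suff v0 : forall i, v 0 i = 0 by apply/rowP => i; rewrite v0 mxE.
apply: e'free.
rewrite -[X in vanishes_on _ X](subrK (\sum_j v 0 j *: \sum_i A j i *: e i)).
apply: vanishes_onD.
  rewrite -sumrB; apply: vanishes_on_sum => j.
  by rewrite -scalerBr; exact: vanishes_onZ.
under eq_bigr do rewrite scaler_sumr.
rewrite exchange_big /=; apply: vanishes_on_sum => i.
have -> : \sum_j v 0 j *: (A j i *: e i) = (v *m M) 0 i *: e i.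
  by rewrite mxE scaler_suml; apply: eq_bigr => j _; rewrite mxE scalerA.
by rewrite vM0 mxE scale0r => L XL w wL; rewrite meval0.
Qed.

Lemma is_hilbert_poly_uniq X P Q :
  is_hilbert_poly X P -> is_hilbert_poly X Q -> P = Q.
Proof.
move=> [m1 hP] [m2 hQ]; apply/eqP; rewrite -subr_eq0; apply/negPn/negP => nz.
pose n := size (P - Q).
pose s := [seq (k%:R : rat) | k <- iota (maxn m1 m2) n].
have us : uniq s.
  by rewrite map_inj_uniq ?iota_uniq // => a b /eqP; rewrite eqr_nat => /eqP.
have rs : all (root (P - Q)) s.
  apply/allP => _ /mapP[k + ->]; rewrite mem_iota geq_max.
  case/andP=> /andP[k1 k2] _; rewrite rootE hornerD hornerN.
  have [h Xh ->] := hP _ k1; have [h' Xh' ->] := hQ _ k2.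
  suff -> : h = h' by rewrite subrr.
  by apply/eqP; rewrite eqn_leq (coord_ring_dim_leq Xh' Xh)
    (coord_ring_dim_leq Xh Xh').
by have := max_poly_roots nz rs us; rewrite size_map size_iota ltnn.
Qed.

Lemma hilbert_polyP X P : is_hilbert_poly X P -> hilbert_poly X = P.
Proof.
move=> hP; apply: xget_unique => // Q hQ; exact: is_hilbert_poly_uniq hQ hP.
Qed.

End ProjectiveDegree.

Section Plucker.

Variables (K : fieldType) (r n : nat).

(* The homogeneous Pluecker coordinates are indexed by the strictly increasing
   r-tuples of columns. *)
Definition plucker_index : {set r.-tuple 'I_n} :=
  [set t : r.-tuple 'I_n | sorted ltn (map val t)].

Definition plucker_coord (M : 'M[K]_(r, n)) : 'rV[K]_#|plucker_index| :=
  \row_i \det (colsub (tnth (enum_val i)) M).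

(* Meaningful for \dim U = r. *)
Definition basis_mx (U : {vspace 'rV[K]_n}) : 'M[K]_(r, n) :=
  \matrix_(i < r) (vbasis U)`_i.

Definition plucker (U : {vspace 'rV[K]_n}) : {vspace 'rV[K]_#|plucker_index|} :=
  <[plucker_coord (basis_mx U)]>%VS.

Definition grassmannian : set {vspace 'rV[K]_n} := [set U | \dim U = r].

(* F_(i+1) is [F i]. *)
Definition is_flag (F : 'I_r -> {vspace 'rV[K]_n}) : Prop :=
  forall i j : 'I_r, (i < j)%N -> (F i <= F j)%VS /\ F i <> F j.

Definition schubert_variety (F : 'I_r -> {vspace 'rV[K]_n}) :
    set {vspace 'rV[K]_n} :=
  [set U | grassmannian U /\ forall i : 'I_r, (i < \dim (U :&: F i))%N].

Definition schubert_plucker_degree (F : 'I_r -> {vspace 'rV[K]_n}) : rat :=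
  degree (plucker @` schubert_variety F)%classic.

End Plucker.

(* Main.v *)
(** A Pluecker coordinate vector of the Schubert variety [X] is, up to scaling
    and a linear change of coordinates, the vector of maximal minors of an
    r x n matrix [M] in staircase form ([M i j = 0] for [j] beyond the i-th entry
    of the top index [b]).  Hodge's standard monomial theory identifies the
    degree-m part of the coordinate ring: the products of minors indexed by the
    chains [b >= a_1 >= ... >= a_m] span it, by straightening with Garnir
    relations, and are independent, by induction over smaller staircases.
    Counting the chains gives [H_b (m + 1) - H_b m = \sum_(a < b) H_a m], so [H_b]
    is a polynomial of degree [|la|] whose leading coefficient [L_b] satisfies
    [|la| * L_b = \sum L_a] over the [a] obtained by decreasing one entry of [b].
    The determinant of the inverse factorials obeys the same recursion, and it
    is positive. *)

Require Import Defs.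
From HB Require Import structures.
From mathcomp Require Import all_boot all_order all_algebra.
From mathcomp Require Import boolp classical_sets reals complex.
From mathcomp Require Import mpoly.
From mathcomp Require Import all_fingroup zify.

Set Implicit Arguments.
Unset Strict Implicit.
Unset Printing Implicit Defensive.

Import Order.TTheory GRing.Theory Num.Theory.

Local Open Scope ring_scope.

(** * Minors *)

Section Columns.

Variables r n : nat.
Local Notation T := 'I_#|plucker_index r n|.

Definition cols (a : T) : 'I_r -> 'I_n := tnth (enum_val a).

Lemma cols_lt (a : T) (i j : 'I_r) : (i < j)%N -> (cols a i < cols a j)%N.
Proof.
have := enum_valP a; rewrite inE => srt ltij.
have ltjn : (j < size (map val (enum_val a)))%N by rewrite size_map size_tuple.
have := sorted_ltn_nth ltn_trans 0%N srt.
move=> /(_ i j (ltn_trans ltij ltjn) ltjn ltij).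
rewrite !(nth_map (cols a i)) ?size_tuple // /cols.
by rewrite -!tnth_nth.
Qed.

Lemma cols_le (a : T) (i j : 'I_r) : (i <= j)%N -> (cols a i <= cols a j)%N.
Proof.
by rewrite leq_eqVlt => /predU1P[/ord_inj -> //|/(cols_lt a)/ltnW].
Qed.

Lemma eq_cols (a b : T) : cols a =1 cols b -> a = b.
Proof. by move=> eqab; apply/enum_val_inj/eq_from_tnth. Qed.

Lemma sorted_colsP (t : r.-tuple 'I_n) :
  sorted ltn (map val t) -> exists a : T, enum_val a = t.
Proof.
move=> srt; have tP : t \in plucker_index r n by rewrite inE.
by exists (enum_rank_in tP t); rewrite enum_rankK_in.
Qed.

Lemma ltn_colsP (f : 'I_r -> 'I_n) :
  (forall i j : 'I_r, (i < j)%N -> (f i < f j)%N) -> exists a : T, cols a =1 f.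
Proof.
move=> flt; have [|a aE] := @sorted_colsP [tuple f i | i < r].
  apply/(sortedP 0%N) => i; rewrite size_map size_tuple => ltir.
  have ltir' := ltnW ltir.
  rewrite !(nth_map (f (Ordinal ltir))) ?size_tuple //.
  rewrite (nth_mktuple _ _ (Ordinal ltir')) (nth_mktuple _ _ (Ordinal ltir)).
  exact: flt.
by exists a => i; rewrite /cols aE tnth_mktuple.
Qed.

(** Obtained by sorting the values of [f]; it turns a minor on distinct columns, in any order, into
    a Pluecker coordinate up to sign. *)
Lemma inj_colsP (f : 'I_r -> 'I_n) : injective f ->
  exists (a : T) (s : 'S_r), forall i, f i = cols a (s i).
Proof.
move=> finj; pose t := [tuple f i | i < r].
have szt : size (sort (fun x y : 'I_n => x <= y)%N t) == r.
  by rewrite size_sort size_tuple.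
have [|a aE] := @sorted_colsP (Tuple szt).
  rewrite /= ltn_sorted_uniq_leq -sort_map sort_uniq sort_sorted ?andbT.
    by rewrite (map_inj_uniq val_inj) (map_inj_uniq finj) enum_uniq.
  exact: leq_total.
have /tuple_permP[s sE] : perm_eq t (enum_val a).
  by rewrite aE /= perm_sym; apply/permPl/perm_sort.
exists a, s => i; have := congr1 (fun u => nth (f i) u i) sE.
by rewrite /cols -!tnth_nth !tnth_mktuple.
Qed.

End Columns.

Section Minors.

Variables (A : comNzRingType) (r n : nat).
Local Notation T := 'I_#|plucker_index r n|.
Implicit Types (M : 'M[A]_(r, n)) (f : 'I_r -> 'I_n).

Definition minor M f : A := \det (colsub f M).

Lemma minorE M f :
  minor M f = \sum_(s : 'S_r) (-1) ^+ s * \prod_j M (s j) (f j).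
Proof.
rewrite /minor -det_tr; apply: eq_bigr => s _; congr (_ * _).
by apply: eq_bigr => i _; rewrite !mxE.
Qed.

Lemma eq_minor M f g : f =1 g -> minor M f = minor M g.
Proof.
by move=> eqfg; congr (\det _); apply/matrixP => i j; rewrite !mxE eqfg.
Qed.

Lemma minor_perm M f (s : 'S_r) : minor M (f \o s) = (-1) ^+ s * minor M f.
Proof.
have -> : minor M (f \o s) = \det (col_perm s (colsub f M)).
  by congr (\det _); apply/matrixP => i j; rewrite !mxE.
by rewrite col_permE det_mulmx det_perm odd_permV mulrC.
Qed.

Lemma minor_noninj M f : ~ injective f -> minor M f = 0.
Proof.
move=> /injectiveP/injectivePn[i [j nij eqij]].
by rewrite /minor -det_tr (determinant_alternate nij) // => k; rewrite !mxE eqij.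
Qed.

Lemma minor_mul (C : 'M[A]_r) M f : minor (C *m M) f = \det C * minor M f.
Proof.
rewrite /minor -det_mulmx; congr (\det _); apply/matrixP => i j.
by rewrite !mxE; apply: eq_bigr => k _; rewrite !mxE.
Qed.

End Minors.

(** A form of the Cauchy-Binet formula: [g] runs over all maps instead of increasing ones, which
    suffices because each [minor M g] is zero or a signed Pluecker coordinate. *)
Lemma minor_mulr (A : comNzRingType) r n p (M : 'M[A]_(r, n))
    (C : 'M[A]_(n, p)) (f : 'I_r -> 'I_p) :
  minor (M *m C) f =
    \sum_(g : {ffun 'I_r -> 'I_n}) (\prod_j C (g j) (f j)) * minor M g.
Proof.
rewrite {1}/minor -det_tr /determinant.
under eq_bigr => s _.
  under eq_bigr => j _ do rewrite !mxE.
  rewrite bigA_distr_bigA big_distrr; over.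
rewrite exchange_big /=; apply: eq_bigr => g _.
rewrite minorE big_distrr; apply: eq_bigr => s _.
by rewrite big_split /= mulrA mulrC.
Qed.

Lemma minor_map (A B : comNzRingType) (h : {rmorphism A -> B}) r n
    (M : 'M[A]_(r, n)) (f : 'I_r -> 'I_n) :
  minor (map_mx h M) f = h (minor M f).
Proof.
by rewrite /minor -det_map_mx; congr (\det _); apply/matrixP => i j; rewrite !mxE.
Qed.

(** * Garnir relations and straightening *)

Section Garnir.

Variables (r n : nat) (a b : 'I_r -> 'I_n) (k : 'I_r).

(* The first k+1 columns of [b], then the columns of [a] from the k-th on; the
   default of [insubd] is never reached. *)
Definition garnir_cols (j : 'I_r.+1) : 'I_n :=
  if (j <= k)%N then b (insubd k (j : nat)) else a (insubd k j.-1).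

(** The [r.+1] slots of [garnir_cols] are shuffled by [s] and dealt out again: slot [j <= k] goes to
    place [j] of the right factor, slot [j > k] to place [j - 1] of the left one. *)
Definition garnir_left (s : 'S_r.+1) (p : 'I_r) : 'I_n :=
  if (p < k)%N then a p else garnir_cols (s (lift ord0 p)).

Definition garnir_right (s : 'S_r.+1) (p : 'I_r) : 'I_n :=
  if (p <= k)%N then garnir_cols (s (widen_ord (leqnSn r) p)) else b p.

(** The places [p >= k] on the left, at slots [p + 1], and [p <= k] on the right, at slots [p],
    together run once through all slots. The operation is abstract because the regrouping serves
    both for products of matrix entries and for sums of column indices. *)
Lemma big_garnir (R : Type) (idx : R) (op : Monoid.com_law idx)
    (X W : 'I_r -> R) (Y Z : 'I_r.+1 -> R) :
  op (\big[op/idx]_(p < r) (if (p < k)%N then X p else Y (lift ord0 p)))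
     (\big[op/idx]_(p < r) (if (p <= k)%N then Z (widen_ord (leqnSn r) p) else W p)) =
  op (op (\big[op/idx]_(p < r | (p < k)%N) X p)
         (\big[op/idx]_(p : 'I_r | ~~ (p <= k)%N) W p))
     (\big[op/idx]_(j < r.+1) (if (j <= k)%N then Z j else Y j)).
Proof.
rewrite !big_if /=.
have -> : \big[op/idx]_(j < r.+1 | (j <= k)%N) Z j =
    \big[op/idx]_(p < r | (p <= k)%N) Z (widen_ord (leqnSn r) p).
  rewrite big_mkcond big_ord_recr /= leqNgt ltn_ord Monoid.mulm1.
  by rewrite [RHS]big_mkcond.
have -> : \big[op/idx]_(j < r.+1 | ~~ (j <= k)%N) Y j =
    \big[op/idx]_(p < r | ~~ (p < k)%N) Y (lift ord0 p).
  by rewrite big_mkcond big_ord_recl /= Monoid.mul1m [RHS]big_mkcond.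
by rewrite -!Monoid.mulmA; congr (op _ _);
  rewrite [LHS]Monoid.mulmC -[LHS]Monoid.mulmA [LHS]Monoid.mulmCA.
Qed.

Lemma garnir_left1 : garnir_left 1 =1 a.
Proof.
move=> p; rewrite /garnir_left /garnir_cols perm1.
case: ltnP => // kp; rewrite lift0; congr a.
by apply/val_inj; rewrite val_insubd ltn_ord.
Qed.

Lemma garnir_right1 : garnir_right 1 =1 b.
Proof.
move=> p; rewrite /garnir_right /garnir_cols perm1 /=.
case: leqP => // kp; congr b.
by apply/val_inj; rewrite val_insubd ltn_ord.
Qed.

(* For fixed permutations in the two Leibniz expansions, the antisymmetrized
   sum is a determinant of order [r.+1] whose rows are indexed through a map to
   ['I_r], so that two of them coincide. *)
Lemma garnir (A : comNzRingType) (M : 'M[A]_(r, n)) :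
  \sum_(s : 'S_r.+1) (-1) ^+ s *
    (minor M (garnir_left s) * minor M (garnir_right s)) = 0.
Proof.
pose F (t u : 'S_r) (j : 'I_r.+1) : 'I_r :=
  if (j <= k)%N then u (insubd k (j : nat)) else t (insubd k j.-1).
pose c (t u : 'S_r) : A := (-1) ^+ t * (-1) ^+ u *
   ((\prod_(p : 'I_r | (p < k)%N) M (t p) (a p)) *
    \prod_(p : 'I_r | ~~ (p <= k)%N) M (u p) (b p)).
have minorsE s : minor M (garnir_left s) * minor M (garnir_right s) =
    \sum_(t : 'S_r) \sum_(u : 'S_r)
      c t u * \prod_j M (F t u j) (garnir_cols (s j)).
  rewrite !minorE big_distrl; apply: eq_bigr => t _.
  rewrite big_distrr; apply: eq_bigr => u _ /=.
  rewrite mulrACA /c -[RHS]mulrA; congr (_ * _).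
  have /= E := @big_garnir A 1 ( *%R : Monoid.com_law 1)
    (fun p => M (t p) (a p)) (fun p => M (u p) (b p))
    (fun j => M (t (insubd k j.-1)) (garnir_cols (s j)))
    (fun j => M (u (insubd k (j : nat))) (garnir_cols (s j))).
  transitivity ((\prod_(p < r) (if (p < k)%N then M (t p) (a p) else
       M (t (insubd k (lift ord0 p).-1)) (garnir_cols (s (lift ord0 p))))) *
    (\prod_(p < r) (if (p <= k)%N then
       M (u (insubd k (p : nat))) (garnir_cols (s (widen_ord (leqnSn r) p)))
       else M (u p) (b p)))).
    congr (_ * _); apply: eq_bigr => p _.
      rewrite /garnir_left; case: ltnP => // kp; congr (M (t _) _).
      by apply/val_inj; rewrite val_insubd ltn_ord.
    rewrite /garnir_right; case: leqP => // kp; congr (M (u _) _).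
    by apply/val_inj; rewrite val_insubd ltn_ord.
  rewrite E; congr (_ * _); apply: eq_bigr => j _.
  by rewrite /F; case: leqP.
under eq_bigr => s _ do rewrite minorsE big_distrr.
rewrite exchange_big /= big1 // => t _.
under eq_bigr => s _ do rewrite big_distrr.
rewrite exchange_big /= big1 // => u _.
under eq_bigr => s _ do rewrite mulrCA.
rewrite -big_distrr /=.
have /injectivePn[i [j nij eqij]] : ~~ injectiveb (F t u).
  apply/negP => /injectiveP/leq_card; rewrite !card_ord ltnn.
  exact/negP.
set S := (X in _ * X).
have -> : S = \det (\matrix_(i, j) M (F t u i) (garnir_cols j)).
  by apply: eq_bigr => s _; congr (_ * _); apply: eq_bigr => l _; rewrite mxE.
by rewrite (determinant_alternate nij) ?mulr0 // => l; rewrite !mxE eqij.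
Qed.

End Garnir.

Section GarnirStraightening.

Variables (r n : nat) (a b : 'I_r -> 'I_n) (k : 'I_r).

Let stab (s : 'S_r.+1) := [forall j, (s j <= k)%N == (j <= k)%N].

(** A shuffle that keeps the two blocks of slots apart only permutes columns within each minor, and
    the signs this produces cancel the sign of [s]. *)
Lemma garnir_stab (A : comNzRingType) (M : 'M[A]_(r, n)) (s : 'S_r.+1) :
  stab s ->
  (-1) ^+ s * (minor M (garnir_left a b k s) * minor M (garnir_right a b k s)) =
  minor M a * minor M b.
Proof.
move=> /forallP st.
have {}st j : (s j <= k)%N = (j <= k)%N by exact: (eqP (st j)).
have loE (j : 'I_r.+1) : (j <= k)%N -> insubd k (j : nat) = j :> nat.
  by move=> jk; rewrite -[LHS]/(val _) val_insubd (leq_ltn_trans jk (ltn_ord k)).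
have hiE (j : 'I_r.+1) : (k < j)%N -> (insubd k j.-1).+1 = j :> nat.
  move=> kj; have := ltn_ord j; rewrite -[insubd k _ : nat]/(val _) val_insubd.
  case: (j : nat) kj => // i _; rewrite ltnS /= => ir.
  by rewrite ir.
pose ft (p : 'I_r) := if (p < k)%N then p else insubd k (s (lift ord0 p)).-1.
pose fu (p : 'I_r) :=
  if (p <= k)%N then insubd k (s (widen_ord (leqnSn r) p) : nat) else p.
have sl (p : 'I_r) : (k <= p)%N -> (k < s (lift ord0 p))%N.
  by move=> kp; rewrite ltnNge st lift0 -ltnNge.
have sw (p : 'I_r) : (p <= k)%N -> (s (widen_ord (leqnSn r) p) <= k)%N.
  by move=> pk; rewrite st.
have ft_inj : injective ft.
  move=> p q; rewrite /ft; case: (ltnP p k) => pk; case: (ltnP q k) => qk //.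
  - move=> E; have := hiE _ (sl _ qk); rewrite -E => H.
    by have := sl _ qk; rewrite -H ltnS leqNgt pk.
  - move=> E; have := hiE _ (sl _ pk); rewrite E => H.
    by have := sl _ pk; rewrite -H ltnS leqNgt qk.
  - move=> /(congr1 (fun i : 'I_r => i.+1)); rewrite !hiE ?sl // => /ord_inj/perm_inj.
    exact: lift_inj.
have fu_inj : injective fu.
  move=> p q; rewrite /fu; case: (leqP p k) => pk; case: (leqP q k) => qk //.
  - move=> /(congr1 (@nat_of_ord r)); rewrite !loE ?sw // => /ord_inj/perm_inj.
    by move/(congr1 val)=> /= /ord_inj.
  - move=> E; have := loE _ (sw _ pk); rewrite E => H.
    by have := sw _ pk; rewrite -H leqNgt qk.
  - move=> E; have := loE _ (sw _ qk); rewrite -E => H.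
    by have := sw _ qk; rewrite -H leqNgt pk.
pose t := perm ft_inj; pose u := perm fu_inj.
have lE : garnir_left a b k s =1 a \o t.
  move=> p; rewrite /garnir_left /= permE /ft; case: ltnP => // kp.
  by rewrite /garnir_cols leqNgt sl.
have rE : garnir_right a b k s =1 b \o u.
  move=> p; rewrite /garnir_right /= permE /fu; case: leqP => // pk.
  by rewrite /garnir_cols sw.
(* Shifted by one, [t] moves only slots above [k], while [u] moves only slots up to [k]; so the sign
   of [s] is the product of the signs of [t] and [u]. *)
have sE : s = (lift_perm ord0 ord0 t * lift_perm ord_max ord_max u)%g.
  apply/permP => j; rewrite permM.
  case: (leqP j k) => jk.
    have -> : lift_perm ord0 ord0 t j = j.
      case: (unliftP ord0 j) => [j' jE|->]; last by rewrite lift_perm_id.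
      rewrite jE lift_perm_lift permE /ft ifT //.
      by move: jk; rewrite jE lift0.
    case: (unliftP ord_max j) => [j' jE|jE]; last first.
      by move: jk; rewrite jE /= leqNgt ltn_ord.
    have jj : j = j' :> nat by rewrite jE lift_max.
    apply/ord_inj; rewrite jE lift_perm_lift lift_max permE /fu -jj jk loE ?sw -?jj //.
    have -> : lift ord_max j' = widen_ord (leqnSn r) j'.
      by apply/ord_inj; rewrite lift_max.
    by [].
  case: (unliftP ord0 j) => [j' jE|jE]; last by move: jk; rewrite jE.
  have jj : j = j'.+1 :> nat by rewrite jE lift0.
  have kj' : (k <= j')%N by rewrite -ltnS -jj.
  have -> : lift_perm ord0 ord0 t j = s j.
    apply/ord_inj; rewrite jE lift_perm_lift permE /ft ifN -?leqNgt //.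
    by rewrite lift0 hiE ?sl.
  have ksj : (k < s j)%N by rewrite ltnNge st -ltnNge.
  case: (unliftP ord_max (s j)) => [i iE|->]; last by rewrite lift_perm_id.
  rewrite {2}iE lift_perm_lift permE /fu.
  have -> : (i <= k)%N = false by rewrite leqNgt -(lift_max i) -iE ksj.
  by rewrite iE.
rewrite (eq_minor M lE) (eq_minor M rE) !minor_perm {1}sE odd_permM.
rewrite !odd_lift_perm !addbb !addFb [X in _ * X]mulrACA.
by rewrite -signr_addb [LHS]mulrA -signr_addb addbb mul1r.
Qed.

(** The positions in [P] hold the values from [c] on, hence the largest ones; a permutation that
    mixes the two blocks brings a smaller value into [P]. *)
Lemma sum_perm_lt (N c : nat) (v : 'I_N -> nat) (P : pred 'I_N) (s : 'S_N) :
  (forall j, P j -> c <= v j)%N -> (forall j, ~~ P j -> v j < c)%N ->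
  (exists j, P (s j) != P j) ->
  (\sum_(j | P j) v (s j) < \sum_(j | P j) v j)%N.
Proof.
move=> vP vNP [i0 ni0].
have [j0 Pj0 nPj0] : exists2 j, P j & ~~ P (s j).
  apply/exists_inP; case: exists_inP => // Ps.
  pose B := [set j | P j].
  have AB : s @: B == B.
    rewrite eqEcard card_imset; last exact: perm_inj.
    rewrite leqnn andbT.
    apply/fintype.subsetP => _ /imsetP[j + ->]; rewrite !inE => Pj.
    by apply/negPn/negP => nPj; apply: Ps; exists j.
  have := mem_imset B i0 (@perm_inj _ s).
  by rewrite (eqP AB) !inE => E; rewrite E eqxx in ni0.
(* The truncated difference vanishes off [P], so its sum over [P] is its total and cannot grow under
   [s]. Strictness comes from [j0], where the new value is below [c]. *)
pose u j := (v j - c)%N.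
apply: (@leq_trans (\sum_(j | P j) (c + u (s j)))).
  rewrite (bigD1 j0) // [leqRHS](bigD1 j0) //= -addSn leq_add //.
    by rewrite (leq_trans (vNP _ nPj0)) ?leq_addr.
  by apply: leq_sum => j _; rewrite -leq_subLR.
rewrite big_split /= [leqRHS](eq_bigr (fun j => c + u j)%N); last first.
  by move=> j Pj; rewrite subnKC ?vP.
rewrite big_split leq_add2l /=.
have -> : (\sum_(j | P j) u j = \sum_j u j)%N.
  rewrite [RHS](bigID P) /= [X in (_ + X)%N]big1 ?addn0 // => j nPj.
  by apply/eqP; rewrite subn_eq0 ltnW ?vNP.
rewrite [leqRHS](reindex_inj (@perm_inj _ s)) /= [leqRHS](bigID P) /=.
exact: leq_addr.
Qed.

End GarnirStraightening.

(** * Linear combinations of functions on a domain *)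

Section LinearCombinations.

Variables (K : fieldType) (V : Type) (D : V -> Prop).

(** Equality is required on [D] alone, so that relations valid only on a staircase can be used. The
    predicate [P] bounds the support while the index type stays the same. *)
Definition lincomb (I : finType) (e : I -> V -> K) (P : pred I) (g : V -> K) :=
  exists2 c : I -> K,
    forall i, c i != 0 -> P i & forall x, D x -> g x = \sum_i c i * e i x.

Section Closure.

Variables (I : finType) (e : I -> V -> K) (P : pred I).

Lemma eq_lincomb g h :
  (forall x, D x -> g x = h x) -> lincomb e P g -> lincomb e P h.
Proof. by move=> gh [c cP cE]; exists c => // x Dx; rewrite -gh // cE. Qed.

Lemma lincomb0 : lincomb e P (fun=> 0).
Proof.
exists (fun=> 0) => [i|x _]; first by rewrite eqxx.
by rewrite big1 // => i _; rewrite mul0r.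
Qed.

Lemma lincombD g h :
  lincomb e P g -> lincomb e P h -> lincomb e P (fun x => g x + h x).
Proof.
move=> [c cP cE] [d dP dE]; exists (fun i => c i + d i) => [i|x Dx].
  have [->|/cP //] := eqVneq (c i) 0; rewrite add0r; exact: dP.
by rewrite cE // dE // -big_split; apply: eq_bigr => i _; rewrite mulrDl.
Qed.

Lemma lincombZ k g : lincomb e P g -> lincomb e P (fun x => k * g x).
Proof.
move=> [c cP cE]; exists (fun i => k * c i) => [i|x Dx].
  by rewrite mulf_eq0 negb_or => /andP[_ /cP].
by rewrite cE // big_distrr /=; apply: eq_bigr => i _; rewrite mulrA.
Qed.

Lemma lincomb_sum (J : Type) (s : seq J) (Q : pred J) (g : J -> V -> K) :
  (forall j, Q j -> lincomb e P (g j)) ->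
  lincomb e P (fun x => \sum_(j <- s | Q j) g j x).
Proof.
move=> gP; elim: s => [|j s IHs].
  by apply: eq_lincomb lincomb0 => x _; rewrite big_nil.
case Qj: (Q j).
  apply: eq_lincomb (lincombD (gP j Qj) IHs) => x _.
  by rewrite big_cons Qj.
by apply: eq_lincomb IHs => x _; rewrite big_cons Qj.
Qed.

Lemma lincomb_gen i : P i -> lincomb e P (e i).
Proof.
move=> Pi; exists (fun j => (j == i)%:R) => [j|x _].
  by have [->|] := eqVneq j i; rewrite ?eqxx.
rewrite (bigD1 i) //= eqxx mul1r big1 ?addr0 // => j /negPf ->.
by rewrite mul0r.
Qed.

End Closure.

Lemma lincomb_trans (I J : finType) (e : I -> V -> K) (P : pred I)
    (f : J -> V -> K) (Q : pred J) g :
  lincomb e P g -> (forall i, P i -> lincomb f Q (e i)) -> lincomb f Q g.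
Proof.
move=> [c cP cE] eQ.
apply: (@eq_lincomb _ _ _ (fun x => \sum_i c i * e i x)).
  by move=> x Dx; rewrite cE.
apply: lincomb_sum => i _; have [->|/cP/eQ] := eqVneq (c i) 0.
  by apply: eq_lincomb (lincomb0 f Q) => x _; rewrite mul0r.
exact: lincombZ.
Qed.

Lemma lincomb_mulr (I : finType) (e : I -> V -> K) (P : pred I) g h :
  lincomb e P g -> lincomb (fun i x => e i x * h x) P (fun x => g x * h x).
Proof.
move=> [c cP cE]; exists c => // x Dx; rewrite cE // big_distrl /=.
by apply: eq_bigr => i _; rewrite mulrA.
Qed.

End LinearCombinations.

Lemma sub_lincomb (K : fieldType) (V : Type) (D D' : V -> Prop) (I : finType)
    (e : I -> V -> K) (P : pred I) g :
  (forall x, D' x -> D x) -> lincomb D e P g -> lincomb D' e P g.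
Proof. by move=> sD [c cP cE]; exists c => // x /sD/cE. Qed.

Lemma lincomb_mul (K : fieldType) (V : Type) (D : V -> Prop) (I J : finType)
    (e : I -> V -> K) (P : pred I) (f : J -> V -> K) (Q : pred J)
    (g h : V -> K) :
  lincomb D e P g -> lincomb D f Q h ->
  lincomb D (fun ij x => e ij.1 x * f ij.2 x) [pred ij | P ij.1 && Q ij.2]
    (fun x => g x * h x).
Proof.
move=> [c cP cE] [d dP dE]; exists (fun ij => c ij.1 * d ij.2).
  by move=> ij; rewrite mulf_eq0 negb_or => /andP[/cP Pi /dP Qj]; rewrite /= Pi Qj.
move=> x Dx; rewrite cE // dE // big_distrlr pair_big /=.
by apply: eq_bigr => ij _; rewrite mulrACA.
Qed.

(** * Straightening a product of two minors *)

Section Straightening.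

Variables (K : numFieldType) (r n : nat).
Local Notation T := 'I_#|plucker_index r n|.

Definition weight (a : T) : nat := \sum_i cols a i.

Definition pcoord (a : T) (M : 'M[K]_(r, n)) : K := minor M (cols a).

Lemma minor_lincomb D (f : 'I_r -> 'I_n) :
  lincomb D pcoord predT (fun M : 'M[K]_(r, n) => minor M f).
Proof.
case: (EM (injective f)) => [/inj_colsP[a [s fE]]|finj].
  apply: eq_lincomb (lincombZ ((-1) ^+ s) (lincomb_gen D pcoord (i := a) _)) => //.
  by move=> M _; rewrite /pcoord -minor_perm; apply: eq_minor => i; rewrite fE.
by apply: eq_lincomb (lincomb0 _ _ _) => M _; rewrite minor_noninj.
Qed.

Lemma pcoord_mulr_lincomb p D (C : 'M[K]_(n, p)) (f : 'I_r -> 'I_p) :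
  lincomb D pcoord predT (fun M : 'M[K]_(r, n) => minor (M *m C) f).
Proof.
apply: (@eq_lincomb _ _ _ _ _ _ (fun M => _)).
  by move=> M _; symmetry; exact: minor_mulr.
by apply: lincomb_sum => g _; exact/lincombZ/minor_lincomb.
Qed.

(** The Garnir relation at the violation [k] is solved for the given product. Every other shuffle
    carries small columns of [b] to the left and large columns of [a] to the right, so the left
    weight drops and the total weight is kept. *)
Lemma straighten2 (a b : T) (k : 'I_r) : (cols b k < cols a k)%N ->
  lincomb (fun=> True) (fun x M => pcoord x.1 M * pcoord x.2 M)
    [pred x | (weight x.1 < weight a)%N &&
              (weight x.1 + weight x.2 == weight a + weight b)%N]
    (fun M => pcoord a M * pcoord b M).
Proof.
move=> ltba.
pose stab (s : 'S_r.+1) := [forall j, (s j <= k)%N == (j <= k)%N].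
pose L s M := minor (A := K) M (garnir_left (cols a) (cols b) k s).
pose R s M := minor (A := K) M (garnir_right (cols a) (cols b) k s).
pose v := garnir_cols (cols a) (cols b) k.
have stab1 : stab 1%g by apply/forallP => j; rewrite perm1.
(* The product occurs once for each block-preserving shuffle; dividing by their number uses
   characteristic zero. *)
have c0 : #|stab|%:R != 0 :> K by rewrite pnatr_eq0 -lt0n; apply/card_gt0P; exists 1%g.
apply: (@eq_lincomb _ _ _ _ _ _ (fun M =>
    \sum_(s | ~~ stab s) (- #|stab|%:R^-1 * (-1) ^+ s) * (L s M * R s M))).
  move=> M _; have := garnir (cols a) (cols b) k M.
  rewrite (bigID stab) /= (eq_bigr (fun=> pcoord a M * pcoord b M)); last first.
    by move=> s; exact: garnir_stab.
  rewrite sumr_const -[X in X + _]mulr_natl => /eqP; rewrite addr_eq0 => /eqP E.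
  apply: (mulfI c0); rewrite [RHS]E -sumrN big_distrr; apply: eq_bigr => s _ /=.
  by rewrite -/(L s M) -/(R s M) !mulNr mulrN -mulrA mulVKf.
apply: lincomb_sum => s nst; apply: lincombZ.
case: (EM (injective (garnir_left (cols a) (cols b) k s))); last first.
  move=> /minor_noninj inj.
  by apply: eq_lincomb (lincomb0 _ _ _) => M _; rewrite /L inj mul0r.
move=> /inj_colsP[x [sx xE]].
case: (EM (injective (garnir_right (cols a) (cols b) k s))); last first.
  move=> /minor_noninj inj.
  by apply: eq_lincomb (lincomb0 _ _ _) => M _; rewrite /R inj mulr0.
move=> /inj_colsP[y [sy yE]].
have wx : weight x = (\sum_p garnir_left (cols a) (cols b) k s p)%N.
  by rewrite /weight (reindex_inj (@perm_inj _ sx)); apply: eq_bigr => p _;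
    rewrite xE.
have wy : weight y = (\sum_p garnir_right (cols a) (cols b) k s p)%N.
  by rewrite /weight (reindex_inj (@perm_inj _ sy)); apply: eq_bigr => p _;
    rewrite yE.
have wa : weight a = (\sum_p garnir_left (cols a) (cols b) k 1%g p)%N.
  by apply: eq_bigr => p _; rewrite garnir_left1.
have wb : weight b = (\sum_p garnir_right (cols a) (cols b) k 1%g p)%N.
  by apply: eq_bigr => p _; rewrite garnir_right1.
pose c : K := (-1) ^+ sx * (-1) ^+ sy.
apply: (@eq_lincomb _ _ _ _ _ _ (fun M => c * (pcoord x M * pcoord y M))).
  move=> M _; rewrite /c /L /R (eq_minor M xE) (eq_minor M yE).
  by rewrite !(minor_perm M (cols _)) mulrACA.
apply: lincombZ.
apply: (lincomb_gen _ (fun x M => pcoord x.1 M * pcoord x.2 M) (i := (x, y))).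
rewrite /= wx wy wa wb.
have sumLE (u : 'S_r.+1) :
    (\sum_p garnir_left (cols a) (cols b) k u p =
     \sum_(p : 'I_r | (p < k)%N) cols a p + \sum_(j : 'I_r.+1 | (k < j)%N) v (u j))%N.
  rewrite /garnir_left; under eq_bigr do rewrite (fun_if (@nat_of_ord n)).
  rewrite big_if /=; congr (_ + _)%N.
  rewrite [RHS]big_mkcond big_ord_recl /= add0n [LHS]big_mkcond /=.
  by apply: eq_bigr => p _; rewrite ltnS -leqNgt.
have sumLRE (u : 'S_r.+1) :
    (\sum_p garnir_left (cols a) (cols b) k u p +
     \sum_p garnir_right (cols a) (cols b) k u p =
     \sum_(p : 'I_r | (p < k)%N) cols a p +
     \sum_(p : 'I_r | ~~ (p <= k)%N) cols b p + \sum_j v j)%N.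
  rewrite [X in _ = (_ + X)%N](reindex_inj (@perm_inj _ u)) /=.
  rewrite /garnir_left /garnir_right -/v.
  under eq_bigr do rewrite (fun_if (@nat_of_ord n)).
  under [X in (_ + X)%N = _]eq_bigr do rewrite (fun_if (@nat_of_ord n)).
  rewrite (big_garnir k addn (fun p => cols a p : nat) (fun p => cols b p : nat)
    (fun j => v (u j) : nat) (fun j => v (u j) : nat)) /=.
  by congr (_ + _)%N; apply: eq_bigr => j _; rewrite if_same.
rewrite !sumLRE eqxx andbT !sumLE ltn_add2l.
have -> : (\sum_(j : 'I_r.+1 | (k < j)%N) v ((1%g : 'S_r.+1) j) =
    \sum_(j : 'I_r.+1 | (k < j)%N) v j)%N.
  by apply: eq_bigr => j _; rewrite perm1.
(* The threshold is the k-th column of [a]: slots above [k] hold this column or later ones of [a],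
   slots up to [k] hold columns of [b] no larger than its k-th, which is smaller by [ltba]. *)
apply: (@sum_perm_lt _ (cols a k)).
- move=> j kj; rewrite /v /garnir_cols ifN -?ltnNge //; apply: cols_le.
  rewrite -[insubd k _ : nat]/(val _) val_insubd; case: ifP => // _.
  by case: (j : nat) kj.
- move=> j; rewrite -leqNgt => jk; rewrite /v /garnir_cols jk.
  apply: leq_ltn_trans ltba; apply: cols_le.
  by rewrite -[insubd k _ : nat]/(val _) val_insubd; case: ifP.
case/forallPn: nst => j nj; exists j.
by rewrite !ltnNge (inj_eq negb_inj).
Qed.

End Straightening.

(** * Standard monomials *)

Lemma big_tuple_cons (R : Type) (idx : R) (op : Monoid.com_law idx)
    (T : finType) m (F : m.+1.-tuple T -> R) :
  \big[op/idx]_t F t =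
  \big[op/idx]_(a : T) \big[op/idx]_(t : m.-tuple T) F [tuple of a :: t].
Proof.
rewrite pair_big /=.
rewrite (reindex (fun p : T * m.-tuple T => [tuple of p.1 :: p.2])) //=.
exists (fun t => (thead t, [tuple of behead t])) => [[a t] _|t _] /=.
  by rewrite theadE; congr (_, _); exact: val_inj.
by rewrite [RHS]tuple_eta.
Qed.

Lemma poly_eq0_nat (K : numFieldType) (p : {poly K}) :
  (forall k : nat, p.[k%:R] = 0) -> p = 0.
Proof.
move=> p0; apply/eqP/negPn/negP => nz.
have := @max_poly_roots _ p [seq k%:R | k <- iota 0 (size p)] nz.
rewrite size_map size_iota ltnn => H.
suff: false by []; apply: H.
  by apply/allP => _ /mapP[k _ ->]; rewrite rootE p0.
by rewrite map_inj_uniq ?iota_uniq // => i j /eqP; rewrite eqr_nat => /eqP.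
Qed.

Section StandardMonomials.

Variables (r n : nat).
Local Notation T := 'I_#|plucker_index r n|.
Implicit Types (a b : T) (s : seq T).

Definition below a b := [forall i, (cols a i <= cols b i)%N].

Definition chain b s := path (fun x y => below y x) b s.

Lemma belowP a b : reflect (forall i, cols a i <= cols b i)%N (below a b).
Proof. exact: forallP. Qed.

Lemma below_refl a : below a a.
Proof. exact/belowP. Qed.

Lemma weight_below a b : below a b -> (weight a <= weight b ?= iff (a == b))%N.
Proof.
move=> /belowP ab; have le : (weight a <= weight b)%N by exact: leq_sum.
split=> //; apply/eqP/eqP => [eqw|->//]; apply: eq_cols => i.
apply/ord_inj/eqP; rewrite eqn_leq ab leqNgt; apply/negP => lt_i.
move: eqw; rewrite /weight (bigD1 i) //= [RHS](bigD1 i) //= => eqw.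
have := leq_add lt_i (leq_sum _ (fun j (_ : j != i) => ab j)).
by move/(_ (index_enum _)); rewrite addSn eqw ltnn.
Qed.

Section Field.

Variable (K : numFieldType).
Implicit Types (M : 'M[K]_(r, n)).

Definition staircase b M := forall i (j : 'I_n), (cols b i < j)%N -> M i j = 0.

Definition std_mon s M : K := \prod_(a <- s) pcoord a M.

Lemma staircase_below a b M : below a b -> staircase a M -> staircase b M.
Proof. by move=> /belowP ab Ma i j bj; apply: Ma; exact: leq_ltn_trans bj. Qed.

(** Where the i-th column of [a] exceeds that of [b], each Leibniz term has a factor in a row at
    most [i] and a column from the i-th of [a] on, outside the staircase. *)
Lemma pcoord_not_below a b M : staircase b M -> ~~ below a b -> pcoord a M = 0.
Proof.
move=> Mb /forallPn; case=> i; rewrite -ltnNge => ltba.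
rewrite /pcoord minorE big1 // => s _.
(* Pigeonhole: the [r - i] positions from [i] on cannot all be sent to the [r - i - 1] rows after
   [i]. *)
have [j ij sj] : exists2 j : 'I_r, (i <= j)%N & (s j <= i)%N.
  pose A := [set j : 'I_r | (i <= j)%N].
  case: (boolP [exists j in A, (s j <= i)%N]) => [/exists_inP[j]|].
    by rewrite inE; exists j.
  rewrite negb_exists_in => /forall_inP sA.
  have : s @: A \subset A :\ i.
    apply/fintype.subsetP => _ /imsetP[j jA ->]; have := sA j jA.
    by rewrite -ltnNge !inE neq_ltn => lt; rewrite lt orbT ltnW.
  move=> /subset_leq_card; rewrite card_imset; last exact: perm_inj.
  by rewrite (cardsD1 i A) inE leqnn add1n ltnn.
rewrite (bigD1 j) //= (Mb (s j) (cols a j)) ?mul0r ?mulr0 //.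
apply: leq_ltn_trans (cols_le b sj) _; apply: leq_trans ltba _.
exact: cols_le.
Qed.

Lemma pcoord_diag b M : staircase b M -> pcoord b M = \prod_i M i (cols b i).
Proof.
move=> Mb; rewrite /pcoord /minor det_trig.
  by apply: eq_bigr => i _; rewrite !mxE.
apply/is_trig_mxP => i j ij; rewrite mxE; apply: Mb; exact: cols_lt.
Qed.

Lemma perm_std_mon s (t : seq T) M : perm_eq s t -> std_mon s M = std_mon t M.
Proof. exact: perm_big. Qed.

(* Straightening an incomparable pair [a, c] with [weight a <= weight c] pushes
   the two weights apart, so it increases the sum of the squared weights, which
   is bounded. *)
Lemma std_mon_span b m s : size s = m ->
  lincomb (staircase b) (fun t : m.-tuple T => std_mon t) (fun t => chain b t)
    (std_mon s).
Proof.
pose N := (r * n)%N.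
have wN a : (weight a <= N)%N.
  have -> : N = (\sum_(i < r) n)%N by rewrite sum_nat_const card_ord.
  by apply: leq_sum => i _; exact: ltnW.
pose q s := (\sum_(a <- s) weight a ^ 2)%N.
have qN u : (q u <= size u * N ^ 2)%N.
  rewrite /q -sum1_size big_distrl /=; apply: leq_sum => a _.
  by rewrite mul1n leq_sqr.
move=> szs; have [d] := ubnP (m * N ^ 2 - q s).
elim: d s szs => // d IHd s szs; rewrite ltnS => qd.
(* Pairwise comparable factors can be sorted into a descending sequence. If this is not a chain
   under [b], its first index is not below [b] and the monomial vanishes on the staircase. *)
case: (boolP (all2rel (fun x y => below x y || below y x) s)) => [/allrelP cmp|].
  pose u := sort (fun x y => below y x) s.
  have us : perm_eq u s by apply/permPl/perm_sort.
  have szu : size u == m by rewrite size_sort szs.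
  apply: (@eq_lincomb _ _ _ _ _ _ (std_mon u)).
    by move=> M _; exact: perm_std_mon.
  have srt : sorted (fun x y => below y x) u.
    apply: (@sort_sorted_in _ (mem s)); last by apply/allP.
    by move=> x y xs ys; rewrite orbC; exact: cmp.
  case: (boolP (chain b u)) => [ch|nch].
    exact: (lincomb_gen _ (fun t : m.-tuple T => std_mon t) (i := Tuple szu)).
  apply: eq_lincomb (lincomb0 _ _ _) => M Mb.
  case: {us szu} u srt nch => // a u /= srt; rewrite /chain /= srt andbT.
  by move=> nab; rewrite /std_mon big_cons (pcoord_not_below Mb nab) mul0r.
case/allPn => x xs /allPn[y ys]; rewrite negb_or => /andP[nxy nyx].
have {x y xs ys nxy nyx} [a [b']] : exists a c, [/\ a \in s, c \in s,
    ~~ below a c, a != c & (weight a <= weight c)%N].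
  have xy : x != y by apply: contraNneq nxy => ->; exact: below_refl.
  case: (leqP (weight x) (weight y)) => w; first by exists x, y.
  by exists y, x; rewrite eq_sym ltnW.
move=> [as_ cs /forallPn[k]]; rewrite -ltnNge => ltk neq_ac wac.
pose s0 := rem b' (rem a s).
have ps : perm_eq s [:: a, b' & s0].
  have psa := perm_to_rem as_; apply: perm_trans (psa) _; rewrite perm_cons.
  apply: perm_to_rem; move: cs; rewrite (perm_mem psa) inE.
  by rewrite eq_sym (negPf neq_ac).
apply: (@eq_lincomb _ _ _ _ _ _ (fun M => pcoord a M * pcoord b' M * std_mon s0 M)).
  by move=> M _; rewrite (perm_std_mon _ ps) /std_mon !big_cons mulrA.
apply: lincomb_trans (lincomb_mulr (std_mon s0)
  (sub_lincomb _ (straighten2 K ltk))) _ => // -[x y] /= /andP[wx /eqP wxy].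
apply: (@eq_lincomb _ _ _ _ _ _ (std_mon [:: x, y & s0])).
  by move=> M _; rewrite /std_mon !big_cons mulrA.
have szxy : size [:: x, y & s0] = m by rewrite -szs (perm_size ps).
apply: IHd => //; apply: leq_trans qd; apply: ltn_sub2l.
  rewrite -szxy; apply: leq_trans (qN _); rewrite /q (perm_big _ ps) /=.
  by rewrite !big_cons !addnA ltn_add2r; nia.
by rewrite /q (perm_big _ ps) /= !big_cons !addnA ltn_add2r; nia.
Qed.

(* Along [M + t * E], with [E] the 0-1 matrix with ones at the corners of the
   staircase, the minor of [b] is a monic polynomial in [t], hence cancellable. *)
Lemma std_mon_cancel m b (c : m.-tuple T -> K) :
  (forall M, staircase b M -> pcoord b M * (\sum_t c t * std_mon t M) = 0) ->
  forall M, staircase b M -> \sum_t c t * std_mon t M = 0.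
Proof.
move=> cb0 M Mb.
pose E : 'M[K]_(r, n) := \matrix_(i, j) (j == cols b i)%:R.
pose Mx := map_mx polyC M + 'X *: map_mx polyC E.
pose q := \sum_t (c t)%:P * \prod_(a <- t) minor Mx (cols a).
have qE x : q.[x] = \sum_t c t * std_mon t (M + x *: E).
  rewrite horner_sum; apply: eq_bigr => t _; rewrite hornerM hornerC.
  congr (_ * _); rewrite horner_prod; apply: eq_bigr => a _.
  rewrite -[LHS]/(horner_eval x _) -minor_map /pcoord; congr (minor _ _).
  apply/matrixP => i j; rewrite !mxE /= /horner_eval hornerD hornerM hornerX.
  by rewrite !hornerC.
suff q0 : q = 0 by have := qE 0; rewrite q0 horner0 scale0r addr0 => <-.
pose d := \prod_i ('X - (- M i (cols b i))%:P).
have /eqP : d * q = 0.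
  apply: poly_eq0_nat => k; rewrite hornerM qE.
  set Mk := M + k%:R *: E.
  have Mkb : staircase b Mk.
    move=> i j bj; rewrite !mxE (Mb i j bj) add0r.
    by case: eqP bj => [->|_ _]; rewrite ?ltnn ?mulr0.
  rewrite -[RHS](cb0 _ Mkb) (pcoord_diag Mkb); congr (_ * _).
  rewrite horner_prod; apply: eq_bigr => i _.
  by rewrite hornerXsubC !mxE eqxx mulr1 opprK addrC.
rewrite mulf_eq0 => /orP[|/eqP //].
by rewrite (negPf (monic_neq0 (monic_prod_XsubC _ _ _))).
Qed.

(* Induction on the first index [a] of the chain: on the staircase of [a] only
   the chains starting at [a] or below survive, and the minor of [a] cancels. *)
Lemma std_mon_free m b (c : m.-tuple T -> K) :
  (forall t, c t != 0 -> chain b t) ->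
  (forall M, staircase b M -> \sum_t c t * std_mon t M = 0) ->
  forall t, c t = 0.
Proof.
elim: m b c => [|m IHm] b c cP c0 t.
  (* In degree 0 the only monomial is the empty product; evaluating at any staircase matrix, here
     the one with ones at the corners, gives its coefficient. *)
  have Mb : staircase b (\matrix_(i, j) (j == cols b i)%:R).
    by move=> i j bj; rewrite mxE; case: eqP bj => // ->; rewrite ltnn.
  have := c0 _ Mb; rewrite (big_pred1 t) => [|u]; last first.
    by apply/esym/eqP; rewrite (tuple0 u) (tuple0 t).
  by rewrite (tuple0 t) /std_mon big_nil mulr1.
case/tupleP: t => a t.
(* The inner induction on the weight of the first index disposes beforehand of the tuples starting
   strictly below [a]. *)
have [d] := ubnP (weight a); elim: d a t => // d IHd a t; rewrite ltnS => wa.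
apply/eqP/negPn/negP => ct; have /andP[ab _] := cP _ ct.
move/negP: ct; apply; apply/eqP.
apply: (IHm a (fun t => c [tuple of a :: t])) => [u /cP /andP[]//|].
apply: std_mon_cancel => M Ma; have := c0 M (staircase_below ab Ma).
rewrite big_tuple_cons (bigD1 a) //= [X in _ + X]big1 => [|a' na'].
  rewrite addr0 => E; rewrite -[RHS]E big_distrr; apply: eq_bigr => u _ /=.
  by rewrite /std_mon big_cons mulrCA.
rewrite big1 // => u _; case: (boolP (below a' a)) => [ba|nba].
  rewrite IHd ?mul0r //; apply: leq_trans wa.
  by rewrite ltn_neqAle !(weight_below ba) na'.
by rewrite /std_mon big_cons (pcoord_not_below Ma nba) mul0r mulr0.
Qed.

End Field.
End StandardMonomials.

(** * Counting chains *)

Lemma coefXD1n (A : comNzRingType) n i : (('X + 1 : {poly A}) ^+ n)`_i = 'C(n, i)%:R.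
Proof.
rewrite addrC exprDn coef_sum.
under eq_bigr do rewrite expr1n mul1r coefMn coefXn mulrb.
case: (leqP i n) => [le_in|lt_ni].
  rewrite (bigD1 (Ordinal (le_in : (i < n.+1)%N))) //= eqxx big1 ?addr0 // => j nj.
  case: eqP => [E|]; last by rewrite mul0rn.
  by case/eqP: nj; apply/val_inj.
rewrite bin_small // big1 // => j _; case: eqP => [E|]; last by rewrite mul0rn.
by have := ltn_ord j; rewrite -E ltnS leqNgt lt_ni.
Qed.

(** A discrete antiderivative, built from the top: the difference of ['X^(d.+1)] has leading term
    [d.+1] times ['X^d], so a multiple of it removes the top coefficient of [Q]. The leading
    coefficient is recorded because it becomes that of the Hilbert polynomial. *)
Lemma poly_antidiff (K : numFieldType) d (Q : {poly K}) : (size Q <= d)%N ->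
  exists P : {poly K}, [/\ (size P <= d.+1)%N,
    forall e, d = e.+1 -> P`_d = Q`_e / d%:R &
    forall x, P.[x + 1] = P.[x] + Q.[x]].
Proof.
elim: d Q => [|d IHd] Q szQ.
  exists 0; rewrite size_poly0; split=> // x.
  by move: szQ; rewrite size_poly_leq0 => /eqP ->; rewrite !horner0 addr0.
pose c := Q`_d / d.+1%:R.
pose R := Q - c *: (('X + 1) ^+ d.+1 - 'X^(d.+1)).
have szR : (size R <= d)%N.
  apply/leq_sizeP => j dj; rewrite coefB coefZ coefB coefXD1n coefXn.
  move: dj; rewrite leq_eqVlt => /predU1P[<-|dj].
    by rewrite binSn ltn_eqF // subr0 divfK ?subrr // pnatr_eq0.
  rewrite (leq_sizeP _ _ szQ) // sub0r.
  move: dj; rewrite leq_eqVlt => /predU1P[<-|dj].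
    by rewrite binn eqxx subrr mulr0 oppr0.
  by rewrite bin_small // gtn_eqF // subr0 mulr0 oppr0.
have [P [szP _ PE]] := IHd R szR.
exists (P + c *: 'X^(d.+1)); split=> [|e [<-]|x].
- apply: leq_trans (size_polyD _ _) _; rewrite geq_max (leq_trans szP) //=.
  by apply: leq_trans (size_scale_leq _ _) _; rewrite size_polyXn.
- by rewrite coefD coefZ coefXn eqxx mulr1 (leq_sizeP _ _ szP) // add0r.
rewrite !hornerD !hornerZ !hornerXn PE /R hornerD hornerN hornerZ hornerD hornerN.
rewrite horner_exp hornerD hornerX hornerXn hornerC mulrBr opprB -!addrA.
by congr (_ + _); rewrite addrC !addrA addrNK addrC.
Qed.

(** * The determinant of inverse factorials *)

Section LeadingCoefficient.

Variable r : nat.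

Definition inv_fact (k j : nat) : rat := if (j <= k)%N then exp_series (k - j) else 0.

Definition exp_det (t : 'I_r -> nat) : rat :=
  \det (\matrix_(i < r, j < r) inv_fact (t i) j).

(** The identity 1/(x-1)! = x/x! for x = k - j, where at x = 0 both sides vanish. The case [k = 0]
    is separate because [k.-1] would be 0 again. *)
Lemma inv_fact_pred k j :
  (if k == 0%N then 0 else inv_fact k.-1 j) = (k%:R - j%:R) * inv_fact k j.
Proof.
rewrite /inv_fact /exp_series; case: k => [|k] /=.
  by case: j => [|j] /=; rewrite ?subrr ?mul0r ?mulr0.
case: (leqP j k) => [jk|].
  rewrite (leqW jk) subSn // factS natrM invfM mulrA -natrB ?leqW // subSn //.
  by rewrite divff ?mul1r // pnatr_eq0.
rewrite leq_eqVlt => /predU1P[<-|kj]; first by rewrite subrr mul0r.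
by rewrite leqNgt kj mulr0.
Qed.

Definition decr (t : 'I_r -> nat) (i l : 'I_r) : nat := (t l - (l == i))%N.

(** In the Leibniz term of [s] the numbers [t i - s i] add up to the same factor for every [s].
    Distributed over the rows, each of them lowers its own [t i] by one through [inv_fact_pred]. *)
Lemma exp_det_rec (t : 'I_r -> nat) :
  ((\sum_i t i)%:R - (\sum_(i < r) i)%:R) * exp_det t =
  \sum_i (if t i == 0%N then 0 else exp_det (decr t i)).
Proof.
transitivity (\sum_i \sum_(s : 'S_r) (-1) ^+ s *
    (((t i)%:R - (s i)%:R) * \prod_l inv_fact (t l) (s l))).
  rewrite exchange_big /exp_det /determinant big_distrr; apply: eq_bigr => s _ /=.
  rewrite -big_distrr -big_distrl /= sumrB mulrCA; congr (_ * (_ * _)).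
    rewrite !natr_sum; congr (_ - _).
    by rewrite (reindex_inj (@perm_inj _ s)).
  by apply: eq_bigr => l _; rewrite mxE.
apply: eq_bigr => i _; case: eqP => ti.
  apply: big1 => s _; rewrite (bigD1 i) //= [X in _ * X]mulrA -inv_fact_pred ti eqxx.
  by rewrite mul0r mulr0.
apply: eq_bigr => s _; congr (_ * _); rewrite (bigD1 i) //= [RHS](bigD1 i) //=.
rewrite mulrA -inv_fact_pred (introF eqP ti) mxE /decr eqxx subn1; congr (_ * _).
by apply: eq_bigr => l /negbTE li; rewrite mxE /decr li subn0.
Qed.

Lemma exp_det_eq0 (t : 'I_r -> nat) i j : i != j -> t i = t j -> exp_det t = 0.
Proof.
move=> nij tij; rewrite /exp_det (determinant_alternate nij) // => l.
by rewrite !mxE tij.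
Qed.

Lemma eq_exp_det (t u : 'I_r -> nat) : t =1 u -> exp_det t = exp_det u.
Proof. by move=> tu; congr (\det _); apply/matrixP => i j; rewrite !mxE tu. Qed.

Lemma exp_det_id : exp_det (@nat_of_ord r) = 1.
Proof.
rewrite /exp_det det_trig.
  by apply: big1 => i _; rewrite mxE /inv_fact leqnn subnn /exp_series invr1.
by apply/is_trig_mxP => i j ij; rewrite mxE /inv_fact leqNgt ij.
Qed.

End LeadingCoefficient.

(** * The polynomial that counts chains *)

Section ChainCount.

Variables (r n : nat).
Local Notation T := 'I_#|plucker_index r n|.
Implicit Types (a b : T).

Let base := (\sum_(i < r) i)%N.

Definition nb_chains b m := #|[pred t : m.-tuple T | chain b t]|.

Lemma nb_chains0 b : nb_chains b 0 = 1%N.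
Proof.
have := card_tuple 0 T; rewrite expn0 => <-.
by apply: eq_card => t; rewrite !inE (tuple0 t).
Qed.

Lemma nb_chainsE b m : nb_chains b m = (\sum_(t : m.-tuple T) chain b t)%N.
Proof.
rewrite /nb_chains -[LHS]sum1_card big_mkcond; apply: eq_bigr => t _.
by rewrite inE; case: ifP.
Qed.

Lemma nb_chainsS b m :
  nb_chains b m.+1 = (\sum_(a | below a b) nb_chains a m)%N.
Proof.
rewrite nb_chainsE big_tuple_cons [RHS]big_mkcond; apply: eq_bigr => a _.
rewrite nb_chainsE; case: ifP => ab; last first.
  by apply: big1 => t _; rewrite /chain /= ab.
by apply: eq_bigr => t _; rewrite /chain /= ab.
Qed.

Lemma leq_cols a (i : 'I_r) : (i <= cols a i)%N.
Proof.
case: i => i; elim: i => // i IHi ltir.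
apply: leq_ltn_trans (IHi (ltnW ltir)) _.
exact: (@cols_lt _ _ a (Ordinal (ltnW ltir)) (Ordinal ltir)).
Qed.

Lemma leq_base a : (base <= weight a)%N.
Proof. by apply: leq_sum => i _; exact: leq_cols. Qed.

(** The distance in weight from the smallest index [0, ..., r - 1]; for the top index of the
    Schubert variety of [la] it is the dimension, the sum of the parts. *)
Definition excess a := (weight a - base)%N.

Definition lead a := exp_det (cols a).

Let sum_eq_op (i : 'I_r) : (\sum_(j < r) (j == i) = 1)%N.
Proof. by rewrite (bigD1 i) //= eqxx big1 // => j /negbTE ->. Qed.

Let isdecr b i a := [forall l, cols a l + (l == i) == cols b l]%N.

(** At most one index arises by lowering the i-th entry of [b]. If none does although the entry is
    positive, the lowered sequence repeats a value and its determinant has two equal rows. *)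
Lemma sum_isdecr b i :
  (if cols b i == 0%N :> nat then 0 else exp_det (decr (cols b) i)) =
  \sum_(a | isdecr b i a) lead a.
Proof.
case: (pickP (isdecr b i)) => [a ad|nd].
  have aE l : (cols a l + (l == i) = cols b l)%N by apply/eqP; exact: (forallP ad).
  rewrite (big_pred1 a) => [|a']; last first.
    apply/idP/eqP => [/forallP a'd|-> //]; apply: eq_cols => l; apply/ord_inj.
    by apply/eqP; rewrite -(eqn_add2r (l == i)) aE.
  rewrite -(aE i) eqxx addn1; apply: eq_exp_det => l.
  by rewrite /decr -aE addnK.
rewrite big_pred0 //; case: eqP => // /eqP bi0.
have [H|] := boolP [forall l : 'I_r, forall l' : 'I_r,
    (l < l')%N ==> (decr (cols b) i l < decr (cols b) i l')%N].
  have lt l : (decr (cols b) i l < n)%N by exact: leq_ltn_trans (leq_subr _ _) _.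
  have [|a aE] := @ltn_colsP _ _ (fun l => Ordinal (lt l)).
    by move=> l l' ll'; have /forallP/(_ l') := forallP H l; rewrite ll'.
  suff : isdecr b i a by rewrite nd.
  apply/forallP => l; rewrite aE /= /decr.
  by have [->|_] := eqVneq l i; rewrite ?subn0 ?addn0 // subnK // lt0n.
case/forallPn=> l /forallPn[l']; rewrite negb_imply -leqNgt => /andP[ll' le].
have lt := cols_lt b ll'; move: le; rewrite {1 2}/decr.
have [l'i|_] := eqVneq l' i; last first.
  by rewrite subn0 leqNgt (leq_ltn_trans (leq_subr _ _) lt).
have li : l != i by rewrite -l'i neq_ltn ll'.
rewrite (negbTE li) subn0 => le; apply: (exp_det_eq0 li).
by rewrite /decr eqxx (negbTE li); move: lt le; rewrite l'i /=; lia.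
Qed.

Lemma isdecr_below b i a :
  isdecr b i a -> below a b && (excess b == (excess a).+1).
Proof.
move=> /forallP ad.
have aE l : (cols a l + (l == i) = cols b l)%N by exact: (eqP (ad l)).
apply/andP; split; first by apply/belowP => l; rewrite -aE leq_addr.
have : (weight b = (weight a).+1)%N.
  rewrite /weight -(eq_bigr _ (fun l _ => aE l)) big_split /=.
  by rewrite sum_eq_op addn1.
by move: (leq_base a); rewrite /excess => le ->; rewrite subSn.
Qed.

(** An index below [b] with weight smaller by one differs from [b] in exactly one entry, so it is
    counted for exactly one [i]. *)
Lemma isdecr_unique b a :
  \sum_(i | isdecr b i a) lead a =
  if below a b && (excess b == (excess a).+1) then lead a else 0.
Proof.
case: ifP => [/andP[ab ex]|nlow].
  have wab : weight b = (weight a).+1.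
    by move: (eqP ex) (leq_base a) (leq_base b); rewrite /excess; lia.
  have [i lti] : exists i, (cols a i < cols b i)%N.
    apply/existsP; rewrite -[X in is_true X]negbK negb_exists.
    apply/negP => /forallP nlt.
    suff /eqP : weight b = weight a by rewrite wab; lia.
    apply: eq_bigr => i _; apply/eqP; rewrite eqn_leq (forallP ab).
    by rewrite leqNgt nlt.
  have ad l : (cols a l + (l == i) = cols b l)%N.
    have le j : (cols a j + (j == i) <= cols b j)%N.
      by have [->|_] := eqVneq j i; rewrite ?addn1 ?addn0 //; exact: (forallP ab).
    (* The entrywise inequality [le] has equal sums on both sides, hence is an equality in every
       entry. *)
    have := @leqif_sum _ predT _ _ _ (fun j _ => leqif_eq (le j)).
    move=> [_]; rewrite big_split /= -/(weight a) -/(weight b) wab.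
    rewrite sum_eq_op addn1 eqxx; by move/esym/forallP/(_ l)/eqP.
  rewrite (big_pred1 i) // => j; apply/idP/eqP => [/forallP jd|->].
    by have := jd i; rewrite -ad eqxx eqn_add2l; case: (eqVneq i j).
  by apply/forallP => l; rewrite ad.
by apply: big_pred0 => i; apply: contraFF nlow => /isdecr_below.
Qed.

(** The recursion of [exp_det_rec], with the sum over lowered entries rewritten as a sum over the
    indices just below [b]: the form met by the leading coefficients of the chain counts. *)
Lemma lead_rec b :
  (excess b)%:R * lead b =
  \sum_(a | below a b && (excess b == (excess a).+1)) lead a.
Proof.
rewrite natrB ?leq_base // exp_det_rec; under eq_bigr do rewrite sum_isdecr.
rewrite (exchange_big_dep predT) //= [RHS]big_mkcond; apply: eq_bigr => a _.
exact: isdecr_unique.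
Qed.

Lemma excess0 b : excess b = 0%N -> forall i, cols b i = i :> nat.
Proof.
move=> eb i; have wb : weight b = base.
  by move: eb (leq_base b); rewrite /excess; lia.
have := @leqif_sum _ predT _ _ _ (fun j (_ : true) => leqif_eq (leq_cols b j)).
by move=> [_]; rewrite -/base -/(weight b) wb eqxx => /esym/forallP/(_ i)/eqP.
Qed.

Lemma lead_excess0 b : excess b = 0%N -> lead b = 1.
Proof. by move=> /excess0 bE; rewrite /lead (eq_exp_det bE) exp_det_id. Qed.

Lemma ex_decr b : (0 < excess b)%N ->
  exists2 a, below a b & excess b = (excess a).+1.
Proof.
(* The entry to lower is the first one above its minimal value: the entries before it are minimal,
   so the sequence stays strictly increasing. *)
move=> eb; have [i bi min_i] : exists2 i : 'I_r, (i < cols b i)%N &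
    forall j : 'I_r, (j < i)%N -> cols b j = j :> nat.
  have /existsP[i0 bi0] : [exists i : 'I_r, (i < cols b i)%N].
    rewrite -[X in is_true X]negbK negb_exists; apply/negP => /forallP nlt.
    move: eb; rewrite subn_gt0 ltnNge => /negP; apply.
    by apply: leq_sum => i _; rewrite leqNgt nlt.
  case: (@arg_minnP _ i0 (fun i : 'I_r => i < cols b i)%N (fun i => i : nat) bi0).
  move=> i bi mini; exists i => // j ji; apply/eqP; rewrite eqn_leq leq_cols andbT.
  by rewrite leqNgt; apply/negP => /mini; rewrite leqNgt ji.
have lt l : (decr (cols b) i l < n)%N by exact: leq_ltn_trans (leq_subr _ _) _.
have [l l' ll'|a aE] := @ltn_colsP _ _ (fun l => Ordinal (lt l)).
  rewrite /= /decr; have := cols_lt b ll'.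
  have [l'i|_] := eqVneq l' i; last by rewrite subn0; exact: leq_ltn_trans (leq_subr _ _).
  have -> : (l == i) = false by rewrite -l'i; apply/negbTE; rewrite neq_ltn ll'.
  by rewrite l'i in ll' *; rewrite (min_i _ ll') => _; move: bi ll'; lia.
have ad : isdecr b i a.
  apply/forallP => l; rewrite aE /= /decr subnK //.
  by have [->|//] := eqVneq l i; rewrite (leq_trans _ bi).
by have /andP[ab /eqP ex] := isdecr_below ad; exists a.
Qed.

(** By [lead_rec], a positive multiple of [lead b] is a nonempty sum of positive terms. Positivity
    is what fixes the exact degree of the Hilbert polynomial. *)
Lemma lead_gt0 b : 0 < lead b.
Proof.
have [d] := ubnP (excess b); elim: d b => // d IHd b; rewrite ltnS => bd.
have [e0|e_gt0] := posnP (excess b); first by rewrite lead_excess0.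
have [a ab ex] := ex_decr e_gt0.
suff : 0 < (excess b)%:R * lead b by rewrite pmulr_rgt0 // ltr0n.
have IH c : below c b && (excess b == (excess c).+1) -> 0 < lead c.
  by move=> /andP[_ /eqP E]; apply: IHd; rewrite -E.
rewrite lead_rec (bigD1 a) /=; last by rewrite ab ex eqxx.
apply: ltr_wpDr.
  by apply: sumr_ge0 => c /andP[/IH c_gt0 _]; exact: ltW.
by apply: IH; rewrite ab ex eqxx.
Qed.

Lemma nb_chains_poly b : exists P : {poly rat},
  [/\ (size P <= (excess b).+1)%N, P`_(excess b) = lead b &
      forall m : nat, P.[m%:R] = (nb_chains b m)%:R].
Proof.
have [d] := ubnP (excess b); elim: d b => // d IHd b; rewrite ltnS => bd.
have nbS m : nb_chains b m.+1 =
    (nb_chains b m + \sum_(a | below a b && (a != b)) nb_chains a m)%N.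
  by rewrite nb_chainsS (bigD1 b) ?below_refl.
have ltex a : below a b && (a != b) -> (excess a < excess b)%N.
  move=> /andP[ab nab]; rewrite ltn_sub2r //.
    by rewrite (leq_ltn_trans (leq_base a)) // ltn_neqAle !(weight_below ab) nab.
  by rewrite ltn_neqAle !(weight_below ab) nab.
have [e0|e_gt0] := posnP (excess b).
  exists 1; rewrite e0 size_poly1 coefC lead_excess0 //; split=> // m.
  rewrite hornerC; elim: m => [|m IHm]; first by rewrite nb_chains0.
  by rewrite nbS big_pred0 ?addn0 // => a; apply/negbTE/negP => /ltex; rewrite e0.
have /choice[p pP] : forall a, exists P : {poly rat}, below a b && (a != b) ->
    [/\ (size P <= (excess a).+1)%N, P`_(excess a) = lead a &
      forall m : nat, P.[m%:R] = (nb_chains a m)%:R].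
  move=> a; case: (boolP (_ && _)) => [ab|]; last by exists 0.
  by have [|P] := IHd a; [exact: leq_trans (ltex _ ab) bd | exists P].
pose Q := \sum_(a | below a b && (a != b)) p a.
have szQ : (size Q <= excess b)%N.
  apply: leq_trans (size_sum _ _ _) _; apply/bigmax_leqP => a ab.
  by have [sz _ _] := pP a ab; exact: leq_trans sz (ltex _ ab).
have [P [szP Ptop PE]] := poly_antidiff szQ.
(* The additive constant is chosen so that the value at 0 is 1, the number of empty chains. *)
exists (P + (1 - P.[0])%:P); split.
- apply: leq_trans (size_polyD _ _) _; rewrite geq_max szP.
  exact: leq_trans (size_polyC_leq1 _) _.
- rewrite coefD coefC gtn_eqF // addr0.
  case E: (excess b) e_gt0 Ptop (lead_rec b) ltex => [//|e] _.
  move=> /(_ e erefl) -> lr ltex.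
  apply: (canLR (mulfK _)); first by rewrite pnatr_eq0.
  (* Of the indices strictly below [b], only those of excess [e] can have a nonzero coefficient in
     degree [e]; they are the ones summed over in [lead_rec]. *)
  rewrite mulrC lr coef_sum [RHS]big_mkcond [LHS]big_mkcond; apply: eq_bigr => a _.
  case: (boolP (below a b)) => //= ab; case: eqP => [->|/eqP nab] /=.
    by rewrite E eqSS ltn_eqF.
  have [sz pe _] := pP a (introT andP (conj ab nab)).
  case: eqP => [[->] //|ne]; apply/(leq_sizeP _ _ sz).
  have := ltex a (introT andP (conj ab nab)); rewrite ltnS leq_eqVlt.
  by case/predU1P => // Ea; case: ne; rewrite Ea.
elim=> [|m IHm]; first by rewrite hornerD hornerC addrC subrK nb_chains0.
rewrite nbS natrD natr_sum -IHm !hornerD !hornerC -natr1 PE addrAC; congr (_ + _).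
rewrite horner_sum; apply: eq_bigr => a ab.
by have [_ _ ->] := pP a ab.
Qed.

End ChainCount.

(** * Schubert varieties as staircase matrices *)

Section Rows.

Variables (K : fieldType) (n : nat).

Lemma extend_basis (vT : vectType K) (X : seq vT) (U : {vspace vT}) :
  free X -> (<<X>> <= U)%VS -> exists Y, basis_of U (X ++ Y).
Proof.
move=> fX XU; exists (vbasis (U :\: <<X>>)).
have /andP[/eqP spY fY] := vbasisP (U :\: <<X>>).
apply/andP; split; first by rewrite span_cat spY addvC addv_diff; apply/eqP/addv_idPl.
rewrite cat_free fX fY spY /=; apply/directv_addP.
by rewrite capvC capv_diff.
Qed.

Lemma dim_basis (vT : vectType K) (X : seq vT) (U : {vspace vT}) :
  basis_of U X -> size X = \dim U.
Proof. by move=> bX; have := @vector.size_basis _ _ U _ (in_tuple X) bX. Qed.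

Definition mx_of_rows m (X : seq 'rV[K]_n) : 'M[K]_(m, n) := \matrix_(i < m) X`_i.

Lemma row_free_rows m (X : seq 'rV[K]_n) :
  size X = m -> free X -> row_free (mx_of_rows m X).
Proof.
move=> szX fX; have szX' : size X == m by rewrite szX.
apply/inj_row_free => v; rewrite mulmx_sum_row => v0.
have /freeP H : free (Tuple szX') by [].
apply/rowP => i; rewrite mxE; apply: (H (fun i => v 0 i)); rewrite -[RHS]v0.
by apply: eq_bigr => j _; rewrite rowK.
Qed.

Lemma free_rows m (A : 'M[K]_(m, n)) :
  row_free A -> free [tuple row i A | i < m].
Proof.
move=> /row_freeP[C AC]; apply/freeP => k k0 i.
have /(congr1 (fun M : 'rV_n => (M *m C) 0 i)) : (\row_j k j) *m A = 0.
  rewrite mulmx_sum_row -[RHS]k0; apply: eq_bigr => j _.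
  by rewrite mxE (nth_mktuple _ _ j).
by rewrite -mulmxA AC mulmx1 mul0mx !mxE.
Qed.

Lemma rows_span m (X : seq 'rV[K]_n) (A : 'M[K]_(m, n)) k : size X = k ->
  (forall i, row i A \in <<X>>%VS) -> exists C, A = C *m mx_of_rows k X.
Proof.
move=> szX AX; have szX' : size X == k by rewrite szX.
exists (\matrix_(i, j) coord (Tuple szX') j (row i A)).
apply/row_matrixP => i; rewrite row_mul mulmx_sum_row.
rewrite [LHS](@coord_span _ _ _ (Tuple szX') _ (AX i)).
by apply: eq_bigr => j _; rewrite rowK !mxE.
Qed.

Lemma minor_row_free r (A : 'M[K]_(r, n)) (f : 'I_r -> 'I_n) :
  minor A f != 0 -> row_free A.
Proof.
move=> nz; have U : colsub f A \in unitmx by rewrite unitmxE unitfE.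
apply/inj_row_free => v v0; rewrite -[v]mulmx1 -(mulmxV U) mulmxA.
have -> : v *m colsub f A = 0; last by rewrite mul0mx.
apply/rowP => i; have := congr1 (fun M : 'rV_n => M 0 (f i)) v0; rewrite !mxE => E.
by rewrite -[RHS]E; apply: eq_bigr => j _; rewrite !mxE.
Qed.

(** The rows of [B] form a basis whose first [\dim (F i)] vectors span [F i] for every [i], and
    [x *m invmx B] lists the coordinates of [x] in it. *)
Lemma flag_basis r (F : 'I_r -> {vspace 'rV[K]_n}) :
  (forall i j : 'I_r, (i < j)%N -> (F i <= F j)%VS) ->
  exists2 B : 'M[K]_n, B \in unitmx &
    forall i x, x \in F i <->
      forall j : 'I_n, (\dim (F i) <= j)%N -> (x *m invmx B) 0 j = 0.
Proof.
move=> Fle.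
have [X [fX spX]] : exists X : seq 'rV[K]_n, free X /\
    forall i, (<<take (\dim (F i)) X>> = F i)%VS.
  (* The list climbs the flag, becoming a basis of one subspace after another; its inclusion in the
     later subspaces is carried along to allow the next extension. *)
  suff /(_ r (leqnn r))[X [fX XF _]] : forall k, (k <= r)%N ->
      exists X : seq 'rV[K]_n, [/\ free X,
        forall i : 'I_r, (i < k)%N -> (<<take (\dim (F i)) X>> = F i)%VS &
        forall i : 'I_r, (k <= i)%N -> (<<X>> <= F i)%VS].
    by exists X; split=> // i; apply: XF.
  elim=> [|k IHk] ltkr.
    by exists [::]; split=> // [|i _]; rewrite ?nil_free // span_nil sub0v.
  have [X [fX XF XsF]] := IHk (ltnW ltkr).
  pose k' := Ordinal ltkr.
  have [Y bY] := extend_basis fX (XsF k' (leqnn k)).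
  exists (X ++ Y); split; first exact: basis_free bY.
    move=> i; rewrite ltnS leq_eqVlt => /predU1P[ik|ik].
      have -> : i = k' by apply/ord_inj.
      by rewrite -(dim_basis bY) take_size (span_basis bY).
    rewrite takel_cat; first exact: XF.
    rewrite -{1}(XF i ik); apply: leq_trans (dim_span _) _.
    by rewrite size_take; case: ltnP => // /ltnW.
  by move=> i ki; rewrite (span_basis bY); apply: Fle.
have [Y bY] := extend_basis fX (subvf _).
set Z := X ++ Y in bY.
have spZ i : (<<take (\dim (F i)) Z>> = F i)%VS.
  rewrite takel_cat ?spX // -{1}(spX i); apply: leq_trans (dim_span _) _.
  by rewrite size_take; case: ltnP => // /ltnW.
have szZ : size Z = n by rewrite (dim_basis bY) dimvf /dim /= mul1n.
pose B := mx_of_rows n Z.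
have uB : B \in unitmx by rewrite -row_free_unit row_free_rows // (basis_free bY).
exists B => // i x; split=> [xF j dj|x0].
  rewrite -(spZ i) in xF.
  rewrite (@coord_span _ _ _ (in_tuple (take (\dim (F i)) Z)) _ xF).
  rewrite mulmx_suml summxE big1 // => l _; rewrite -scalemxAl mxE.
  have := ltn_ord l; rewrite {2}size_take_min => ll.
  have ln : (l < n)%N.
    by apply: leq_trans ll _; apply: leq_trans (geq_minr _ _) _; rewrite szZ.
  have ld : (l < \dim (F i))%N by apply: leq_trans ll _; exact: geq_minl.
  rewrite /= nth_take //.
  have -> : Z`_l = row (Ordinal ln) B by rewrite rowK.
  rewrite -row_mul mulmxV // !mxE; case: eqP => [E|]; last by rewrite mulr0.
  by move: dj; rewrite -E /= leqNgt ld.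
rewrite -[x](mulmxKV uB) mulmx_sum_row -(spZ i); apply: memv_suml => j _.
case: (leqP (\dim (F i)) j) => dj; first by rewrite x0 // scale0r mem0v.
apply/memvZ/memv_span; rewrite rowK -(nth_take _ dj); apply: mem_nth.
by rewrite size_take; case: ifP => //; rewrite szZ.
Qed.

End Rows.

Lemma meval_homog (K : fieldType) N m (p : {mpoly K[N]}) (c : K) (v : 'I_N -> K) :
  p \is m.-homog -> p.@[fun i => c * v i] = c ^+ m * p.@[v].
Proof.
move=> /dhomogP hp; rewrite !mevalE big_distrr [LHS]big_seq [RHS]big_seq.
apply: eq_bigr => mm /hp mdm /=; rewrite mulrCA; congr (_ * _).
under eq_bigr do rewrite exprMn.
by rewrite big_split /= -expr_sum -mdegE mdm mulrC.
Qed.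

(** * Points of the Schubert variety and staircase matrices *)

Section SchubertVariety.

Variables (K : numFieldType) (r n : nat) (F : 'I_r -> {vspace 'rV[K]_n}).
Variables (b : 'I_#|plucker_index r n|) (B : 'M[K]_n).
Hypothesis B_unit : B \in unitmx.
Hypothesis B_flag : forall i x, x \in F i <->
  forall j : 'I_n, (cols b i < j)%N -> (x *m invmx B) 0 j = 0.

(** The incidence conditions provide a basis of [U] whose i-th vector lies in [F i]; its coordinates
    in the adapted basis form a staircase matrix. *)
Lemma schubert_staircase U : schubert_variety F U ->
  exists M H, staircase b M /\ basis_mx r U = H *m (M *m B).
Proof.
move=> [dimU dimUF]; rewrite /grassmannian /= in dimU.
have [s [szs fs sUF]] : exists s : seq 'rV[K]_n, [/\ size s = r, free s &
    forall i : 'I_r, s`_i \in (U :&: F i)%VS].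
  suff /(_ r (leqnn r))[s [? ? sUF]] : forall k, (k <= r)%N ->
      exists s : seq 'rV[K]_n, [/\ size s = k, free s &
      forall i : 'I_r, (i < k)%N -> s`_i \in (U :&: F i)%VS].
    by exists s; split=> // i; apply: sUF.
  elim=> [|k IHk] ltkr; first by exists [::]; split=> //; exact: nil_free.
  have [s [szs fs sUF]] := IHk (ltnW ltkr).
  pose k' := Ordinal ltkr.
  (* The intersection has dimension greater than [k], so the span of the [k] vectors already chosen
     cannot contain it. *)
  have /subvPn[v vUF nvs] : ~~ (U :&: F k' <= <<s>>)%VS.
    apply/negP => /dimvS; rewrite leqNgt; move: fs => /eqP ->.
    by rewrite szs; have /= -> := dimUF k'.
  exists (rcons s v); split; first by rewrite size_rcons szs.
    by rewrite (perm_free (_ : perm_eq _ (v :: s))) ?perm_rcons // free_cons nvs.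
  move=> i; rewrite ltnS leq_eqVlt nth_rcons szs => /predU1P[ik|ik].
    have -> : i = k' by apply/ord_inj.
    by rewrite /= ltnn eqxx.
  by rewrite ik sUF.
exists (mx_of_rows r s *m invmx B).
have [|H HE] := @rows_span _ _ r s (basis_mx r U) r szs.
  have sU : basis_of U s.
    rewrite basisEfree fs szs dimU leqnn andbT /=; apply/span_subvP => x.
    move=> /(nthP 0)[l]; rewrite szs => ir <-.
    by have := sUF (Ordinal ir); rewrite memv_cap => /andP[].
  move=> i; rewrite (span_basis sU) rowK; apply: vbasis_mem; apply: mem_nth.
  by rewrite size_tuple dimU.
exists H; split; last by rewrite mulmxKV.
move=> i j bj; have := sUF i; rewrite memv_cap => /andP[_ /B_flag/(_ j bj)].
have -> : s`_i = row i (mx_of_rows r s) by rewrite rowK.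
by rewrite -row_mul mxE.
Qed.

(** The first [i.+1] rows of [M *m B] lie in [F i] and are independent, which gives the i-th
    incidence condition for the row space. *)
Lemma staircase_schubert M : staircase b M -> row_free (M *m B) ->
  exists U G, schubert_variety F U /\ M *m B = G *m basis_mx r U.
Proof.
move=> Mb /free_rows fX; set X := [tuple row i (M *m B) | i < r] in fX.
have XE (i : 'I_r) : X`_i = row i (M *m B) by rewrite nth_mktuple.
have dimX : \dim <<X>> = r by move: fX => /eqP ->; rewrite size_tuple.
exists <<X>>%VS.
have [|i|G GE] := @rows_span _ _ r (vbasis <<X>>) (M *m B) r.
- by rewrite size_tuple dimX.
- by rewrite (span_basis (vbasisP _)) -XE memv_span // mem_nth // size_tuple.
exists G; split=> //; split=> // i.
pose s := take i.+1 X.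
have szs : size s = i.+1 by rewrite size_takel // size_tuple.
have fs : free s by move: fX; rewrite -[in free _](cat_take_drop i.+1 X) => /catl_free.
apply: leq_trans (_ : \dim <<s>> <= _)%N; first by move: fs => /eqP ->; rewrite szs.
apply: dimvS; apply/span_subvP => x xs; rewrite memv_cap.
rewrite (memv_span (mem_take xs)) /=.
have /(nthP 0)[l] := xs; rewrite szs => li <-; rewrite nth_take //.
have lr : (l < r)%N by apply: leq_trans li _.
rewrite (XE (Ordinal lr)); apply/B_flag => j bj.
rewrite -row_mul mulmxK // mxE; apply: Mb; apply: leq_ltn_trans bj.
exact: cols_le.
Qed.

(** Changing the basis of [U] multiplies all maximal minors by one determinant, which a form absorbs
    by homogeneity. *)
Lemma vanishes_schubert m p : (0 < m)%N -> p \is m.-homog ->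
  vanishes_on (@plucker K r n @` schubert_variety F)%classic p <->
  forall M, staircase b M -> p.@[fun a => pcoord a (M *m B)] = 0.
Proof.
move=> m0 hp; split=> [X0 M Mb|M0 _ [U XU <-] v].
  have [fr|nfr] := boolP (row_free (M *m B)).
    have [U [G [XU GE]]] := staircase_schubert Mb fr.
    rewrite (@meval_eq _ _ _ (fun a => \det G * plucker_coord (basis_mx r U) 0 a)).
      rewrite (meval_homog _ _ hp) (X0 (@plucker K r n U)) ?mulr0 //.
      exact: memv_line.
    by move=> a; rewrite mxE /pcoord GE minor_mul.
  (* In rank below [r] every maximal minor is zero, and a form of positive degree vanishes at the
     origin; this is where [0 < m] enters. *)
  rewrite (@meval_eq _ _ _ (fun a => 0 * pcoord a (M *m B))).
    by rewrite (meval_homog _ _ hp) expr0n gtn_eqF // mul0r.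
  move=> a; rewrite mul0r; apply/eqP; apply: contraNT nfr; exact: minor_row_free.
have [M [H [Mb UE]]] := schubert_staircase XU.
move=> /vlineP[c ->].
rewrite (@meval_eq _ _ _ (fun a => (c * \det H) * pcoord a (M *m B))).
  by rewrite (meval_homog _ _ hp) M0 // mulr0.
by move=> a; rewrite !mxE UE -/(minor _ (cols a)) minor_mul mulrA.
Qed.

End SchubertVariety.

(** * The homogeneous coordinate ring *)

Section CoordinateRing.

Variables (K : numFieldType) (r n : nat).
Local Notation T := 'I_#|plucker_index r n|.

Definition monspan D m (g : 'M[K]_(r, n) -> K) :=
  lincomb D (fun t : m.-tuple T => std_mon t) predT g.

Lemma monspan1 D : monspan D 0 (fun=> 1).
Proof.
apply: eq_lincomb (lincomb_gen D _ (i := [tuple]) _) => // M _.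
by rewrite /std_mon big_nil.
Qed.

Lemma monspan_pcoord D a : monspan D 1 (pcoord a).
Proof.
apply: eq_lincomb (lincomb_gen D _ (i := [tuple a]) _) => // M _.
by rewrite /std_mon big_seq1.
Qed.

Lemma monspan_mul D m m' g h :
  monspan D m g -> monspan D m' h -> monspan D (m + m') (fun M => g M * h M).
Proof.
move=> gm hm; apply: lincomb_trans (lincomb_mul gm hm) _ => -[t t'] _.
apply: eq_lincomb (lincomb_gen D _ (i := [tuple of t ++ t']) _) => // M _.
by rewrite /std_mon big_cat.
Qed.

Lemma monspan_linear D (C : 'M[K]_n) (a : T) :
  monspan D 1 (fun M => pcoord a (M *m C)).
Proof.
apply: lincomb_trans (pcoord_mulr_lincomb _ C (cols a)) _ => c _.
exact: monspan_pcoord.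
Qed.

Lemma monspan_prod D (C : 'M[K]_n) (e : T -> nat) :
  monspan D (\sum_a e a) (fun M => \prod_a pcoord a (M *m C) ^+ e a).
Proof.
elim: (index_enum T) => [|a s IHs].
  rewrite big_nil; apply: eq_lincomb (monspan1 D) => M _; by rewrite big_nil.
rewrite big_cons; apply: (@eq_lincomb _ _ _ _ _ _ (fun M =>
    pcoord a (M *m C) ^+ e a * \prod_(a <- s) pcoord a (M *m C) ^+ e a)).
  by move=> M _; rewrite big_cons.
apply: monspan_mul IHs; elim: (e a) => [|k IHk]; first exact: monspan1.
apply: eq_lincomb (monspan_mul (monspan_linear _ C a) IHk) => M _.
by rewrite exprS.
Qed.

(** The minors of [M *m C] are linear in those of [M], so a form of degree [m] becomes a combination
    of products of [m] minors, and straightening reduces these to chains. *)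
Lemma meval_span b (C : 'M[K]_n) m (p : {mpoly K[#|plucker_index r n|]}) :
  p \is m.-homog ->
  lincomb (staircase b) (fun t : m.-tuple T => std_mon t) (fun t => chain b t)
    (fun M => p.@[fun a => pcoord a (M *m C)]).
Proof.
move=> /dhomogP hp.
apply: (lincomb_trans (e := fun t : m.-tuple T => std_mon t) (P := predT)); last first.
  by move=> t _; apply: std_mon_span; rewrite size_tuple.
apply: (@eq_lincomb _ _ _ _ _ _ (fun M => \sum_(mm <- msupp p | mm \in msupp p)
    p@_mm * \prod_a pcoord a (M *m C) ^+ mm a)).
  by move=> M _; rewrite mevalE [RHS]big_seq.
apply: lincomb_sum => mm /hp mdm; apply: lincombZ; rewrite -mdm /= mdegE.
exact: monspan_prod.
Qed.

(** The change of coordinates is undone by expanding the minors of [(M *m B) *m invmx B] linearly in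
    those of [M *m B]. *)
Lemma ex_linear_form (B : 'M[K]_n) (a : T) : B \in unitmx ->
  exists2 y : {mpoly K[#|plucker_index r n|]}, y \is 1.-homog &
    forall M : 'M[K]_(r, n), y.@[fun c => pcoord c (M *m B)] = pcoord a M.
Proof.
move=> uB.
have [k _ kE] := pcoord_mulr_lincomb (fun=> True) (invmx B) (cols a).
exists (\sum_c k c *: 'X_c).
  by apply: rpred_sum => c _; apply: dhomogZ; rewrite dhomogX /= mdeg1.
move=> M; transitivity (minor (M *m B *m invmx B) (cols a)); last first.
  by rewrite mulmxK.
rewrite kE // (raddf_sum (meval _)) /=.
by apply: eq_bigr => c _; rewrite mevalZ mevalXU.
Qed.

(** The basis consists of one product of linear forms for each chain; pulled back to staircase
    matrices it becomes the standard monomials, which are independent and spanning. *)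
Lemma coord_ring_dim_chains b (B : 'M[K]_n) X m : B \in unitmx ->
  (forall p : {mpoly K[#|plucker_index r n|]}, p \is m.-homog ->
    (vanishes_on X p <->
      forall M, staircase b M -> p.@[fun a => pcoord a (M *m B)] = 0)) ->
  coord_ring_dim X m (nb_chains b m).
Proof.
move=> uB Xm.
have /choice[y yP] : forall a : T, exists y : {mpoly K[#|plucker_index r n|]},
    y \is 1.-homog /\
    forall M : 'M[K]_(r, n), y.@[fun c => pcoord c (M *m B)] = pcoord a M.
  by move=> a; have [y y1 yE] := ex_linear_form a uB; exists y.
pose A := [pred t : m.-tuple T | chain b t].
pose e (t : seq T) := \prod_(a <- t) y a.
have eE (t : seq T) M : (e t).@[fun a => pcoord a (M *m B)] = std_mon t M.
  rewrite (rmorph_prod (meval _)); apply: eq_bigr => a _.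
  by have [_ yE] := yP a; exact: yE.
have e_homog (t : m.-tuple T) : e t \is m.-homog.
  rewrite -[X in X.-homog](size_tuple t) /e.
  elim: (tval t) => [|a s IHs]; first by rewrite big_nil dhomog1.
  by rewrite big_cons /= -add1n; apply: dhomogM => //; have [] := yP a.
have combE (c : 'I_#|A| -> K) M :
    (\sum_i c i *: e (enum_val i)).@[fun a => pcoord a (M *m B)] =
    \sum_i c i * std_mon (enum_val i) M.
  rewrite (raddf_sum (meval _)) /=; apply: eq_bigr => i _.
  by rewrite mevalZ eE.
have comb_homog (c : 'I_#|A| -> K) : \sum_i c i *: e (enum_val i) \is m.-homog.
  by apply: rpred_sum => i _; apply/dhomogZ/e_homog.
rewrite /nb_chains -/A.
exists (fun i : 'I_#|A| => e (enum_val i));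
  split=> [i|c /(Xm _ (comb_homog c)) c0 i|p hp].
- exact: e_homog.
(* The coefficients are extended by zero from chains to all tuples, the form in which [std_mon_free]
   takes them. *)
- pose d (t : m.-tuple T) := \sum_(j | enum_val j == t) c j.
  have dE j : d (enum_val j) = c j.
    by rewrite /d (big_pred1 j) // => l; rewrite (inj_eq enum_val_inj).
  rewrite -dE; apply: (@std_mon_free _ _ _ _ b) => [t|M Mb].
    apply: contraNT => nt; rewrite /d big_pred0 // => j; apply/negP => /eqP jt.
    by move: nt; rewrite -jt; have := enum_valP j; rewrite inE => ->.
  rewrite -[RHS](c0 M Mb) combE.
  under eq_bigr => t _ do rewrite /d big_distrl.
  rewrite (exchange_big_dep predT) //=; apply: eq_bigr => j _.
  by rewrite (big_pred1 (enum_val j)) // => t; rewrite eq_sym.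
have [c cA cE] := meval_span b B hp.
exists (fun i : 'I_#|A| => c (enum_val i)); apply/Xm.
  by rewrite rpredB.
move=> M Mb; rewrite mevalB combE cE // -(big_enum_val (fun t => c t * std_mon t M)) /=.
rewrite (bigID (mem A)) /= addrAC subrr add0r big1 // => t nA.
have -> : c t = 0 by apply/eqP; apply: contraNT nA => /cA; rewrite inE.
by rewrite mul0r.
Qed.

End CoordinateRing.

(** * The degree *)

(** The part belonging to the last column is zero, so that column is [(0, ..., 0, 1)] and expanding
    along it leaves the smaller determinant. *)
Lemma schur_detS s (la : seq nat) : (size la <= s)%N ->
  schur_det s.+1 la exp_series = schur_det s la exp_series.
Proof.
move=> las; rewrite /schur_det (expand_det_col _ ord_max) big_ord_recr /=.
rewrite big1 => [|i _]; last first.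
  by rewrite mxE /= nth_default // add0n leqNgt ltn_ord mul0r.
rewrite add0r mxE /= nth_default // add0n leqnn subnn /exp_series invr1 mul1r.
rewrite /cofactor addnn -mul2n exprM sqrrN !expr1n mul1r; congr (\det _).
by apply/matrixP => i j; rewrite !mxE !lift_max.
Qed.

Lemma schur_det_size s (la : seq nat) : (size la <= s)%N ->
  schur_det s la exp_series = schur_det (size la) la exp_series.
Proof.
move=> /subnK <-; elim: (s - size la)%N => // k <-.
by rewrite addSn schur_detS // leq_addl.
Qed.

(* Transposing and reversing both index sets turns the partition into the
   increasing sequence of the [i + la_(r-i)]. *)
Lemma schur_det_exp_det r (la : seq nat) :
  schur_det r la exp_series =
  exp_det (fun i : 'I_r => (i + nth 0 la (r - i.+1))%N).
Proof.
rewrite /exp_det /schur_det -det_tr.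
set A := (X in \det X = _); pose s := perm (@rev_ord_inj r).
transitivity (\det (row_perm s (col_perm s A))).
  rewrite row_permE col_permE !det_mulmx !det_perm odd_permV mulrC -mulrA.
  by rewrite -signr_addb addbb mulr1.
congr (\det _); apply/matrixP => i j; rewrite !mxE !permE /= /inv_fact.
have ltir := ltn_ord i; have ltjr := ltn_ord j.
set l := nth 0%N la _.
have -> : (r - i.+1 <= l + (r - j.+1))%N = (j <= i + l)%N by lia.
by case: ifP => // le; congr exp_series; lia.
Qed.

Lemma sumn_nth r (la : seq nat) : (size la <= r)%N ->
  sumn la = (\sum_(i < r) nth 0 la (r - i.+1))%N.
Proof.
move=> lar; rewrite (reindex_inj rev_ord_inj) /=.
transitivity (\sum_(0 <= i < r) nth 0 la i)%N; last first.
  rewrite big_mkord; apply: eq_bigr => i _; congr nth.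
  by have := ltn_ord i; lia.
rewrite (big_cat_nat (leq0n (size la)) lar) /= [X in (_ + X)%N]big_nat_cond.
rewrite [X in (_ + X)%N]big1 => [|i].
  by rewrite addn0 sumnE (big_nth 0%N).
by rewrite andbT => /andP[lai _]; rewrite nth_default.
Qed.

Lemma schubert_degree (K : numFieldType) (la : seq nat) (r n : nat)
    (F : 'I_r -> {vspace 'rV[K]_n}) :
  is_partition la -> (size la <= r)%N -> (r <= n)%N ->
  (nth 0 la 0 <= n - r)%N ->
  (forall i j : 'I_r, (i < j)%N -> (F i <= F j)%VS) ->
  (forall i : 'I_r, \dim (F i) = (i.+1 + nth 0 la (r - i.+1))%N) ->
  schubert_plucker_degree F = (sumn la)`!%:R * schur_det r la exp_series.
Proof.
move=> /andP[la_srt _] lar rn la0 F_le F_dim.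
have la_le i j : (i <= j)%N -> (nth 0 la j <= nth 0 la i)%N.
  case: (ltnP j (size la)) => [ltj ij|lej _]; last by rewrite (nth_default _ lej).
  have geq_trans : transitive geq by move=> x y z xy yz; exact: leq_trans yz xy.
  exact: (sorted_leq_nth geq_trans (@leqnn : reflexive geq) 0%N la_srt _ _
    (leq_ltn_trans ij ltj) ltj ij).
(* Counting from 0, [t i] is [\dim (F i) - 1], the last coordinate that may be nonzero on [F i];
   these values form the top index [b]. *)
pose t (i : 'I_r) := (i + nth 0 la (r - i.+1))%N.
have t_lt i : (t i < n)%N.
  by rewrite /t; have := la_le 0%N (r - i.+1)%N isT; have := ltn_ord i; lia.
have [|b bE] := @ltn_colsP _ _ (fun i => Ordinal (t_lt i)).
  move=> i j ij; rewrite /= /t.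
  by have := @la_le (r - j.+1)%N (r - i.+1)%N; lia.
have bt i : cols b i = t i :> nat by rewrite bE.
have [B uB BF] := flag_basis F_le.
have B_flag i x : x \in F i <->
    forall j : 'I_n, (cols b i < j)%N -> (x *m invmx B) 0 j = 0.
  by rewrite BF F_dim; split=> H j; have := H j; rewrite bt.
have [P [szP Ptop PE]] := nb_chains_poly b.
have leadE : lead b = schur_det r la exp_series.
  by rewrite schur_det_exp_det; exact: eq_exp_det.
have excessE : excess b = sumn la.
  rewrite (sumn_nth lar) /excess /weight (eq_bigr _ (fun i _ => bt i)).
  by rewrite /t big_split /= addKn.
have hP : is_hilbert_poly (@plucker K r n @` schubert_variety F)%classic P.
  exists 1%N => m m1; exists (nb_chains b m); last exact: PE.
  apply: coord_ring_dim_chains (uB) _ => p hp.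
  exact: vanishes_schubert uB B_flag _ _ m1 hp.
(* The coefficient in degree [excess b] is positive, so the degree of [P] is the sum of the parts
   and the factorial in [degree] is the required one. *)
have szP' : size P = (excess b).+1.
  apply/eqP; rewrite eqn_leq szP ltnNge; apply/negP => /leq_sizeP/(_ _ (leqnn _)).
  by apply/eqP; rewrite Ptop gt_eqF // lead_gt0.
rewrite /schubert_plucker_degree /degree (hilbert_polyP hP) lead_coefE szP' /=.
by rewrite Ptop leadE excessE.
Qed.

Theorem corollary3p2 (R : realType) (la : seq nat) (r n s : nat)
    (F : 'I_r -> {vspace 'rV[R[i]]_n})
    (la_part : is_partition la)
    (la_parts : (size la <= r)%N) (la_first : (r <= n)%N /\ (nth 0 la 0 <= n - r)%N)
    (F_flag : is_flag F)
    (F_dim : forall i : 'I_r, \dim (F i) = (i.+1 + nth 0 la (r - i.+1))%N)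
    (s_ge : (size la <= s)%N) :
  schubert_plucker_degree F = (sumn la)`!%:R * schur_det s la exp_series.
Proof.
(* The orders [s] and [r] are both compared with the smallest admissible one, [size la]. *)
case: la_first => rn la0; rewrite (schur_det_size s_ge) -(schur_det_size la_parts).
apply: schubert_degree => // i j ij.
by case: (F_flag i j ij).
Qed.
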